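(* Let $U$ be a two-qubit unitary, and for $n\in\mathbb{N}$ let $U^{\otimes n}$ act on $n$ disjoint pairs of qubits, with $A$ (respectively $B$) the tensor product of the first (respectively second) qubits of all pairs. Let $S$ stand for either $\mathrm{LO}$ or $\mathrm{LOCC}$ (with respect to the bipartition $A,B$, for each $n$). If $\gamma_S(U)>1$, then for every integer $n\ge2$, $$\gamma_S(U^{\otimes n})<\gamma_S(U)^n .$$
   Context: All Hilbert spaces are finite-dimensional. $\mathrm{CPTP}(X)$ is the set of completely positive trace-preserving maps on system $X$. Local operations: $\mathcal{N}(X)=\{\mathcal{A}^+-\mathcal{A}^-:\ \mathcal{A}^\pm \text{ completely positive},\ \mathcal{A}^++\mathcal{A}^-\in\mathrm{CPTP}(X)\}$ and $\mathrm{LO}(A,B)=\{\mathcal{F}_A\otimes\mathcal{F}_B:\ \mathcal{F}_A\in\mathcal{N}(A),\ \mathcal{F}_B\in\mathcal{N}(B)\}$. LOCC: an instrument is a finite family $(\mathcal{E}_i)$ of completely positive maps whose sum is trace preserving. A one-way local instrument from $A$ has the form $(\mathcal{E}_i\otimes\mathcal{T}_i)_i$ with $(\mathcal{E}_i)$ an instrument on $A$ and each $\mathcal{T}_i$ CPTP on $B$ (analogously from $B$). An LOCC instrument is obtained by finitely many rounds, in each of which a one-way local instrument (from $A$ or from $B$, possibly changing the local finite dimensions) is applied that may depend on all previous outcomes, followed by coarse-graining (summing) of outcomes. $\mathrm{LOCC}(A,B)$ is the set of maps $\sum_i s_i\mathcal{E}_i$ on $AB$ with $(\mathcal{E}_i)$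 an LOCC instrument and $s_i\in\{+1,-1\}$. $\gamma$-factor: for a linear map $\mathcal{E}$ on $AB$ and $S\in\{\mathrm{LO}(A,B),\mathrm{LOCC}(A,B)\}$, $\gamma_S(\mathcal{E})=\min\{\sum_{i=1}^m|a_i| : \mathcal{E}=\sum_{i=1}^m a_i\mathcal{F}_i,\ m\ge1,\ \mathcal{F}_i\in S,\ a_i\in\mathbb{R}\}$. For a unitary $U$, $\gamma_S(U)$ means $\gamma_S$ of the channel $\rho\mapsto U\rho U^\dagger$. *)

(* Defs.v *)
From HB Require Import structures.
From mathcomp Require Import all_boot all_order all_algebra.
From mathcomp Require Import complex mxtens.
From mathcomp Require Import reals.

Set Implicit Arguments.
Unset Strict Implicit.
Unset Printing Implicit Defensive.

Import Order.TTheory GRing.Theory Num.Theory.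
Local Open Scope ring_scope.
Local Open Scope complex_scope.
Local Open Scope sesquilinear_scope.

(* Linear maps from operators on C^m to operators on C^n. *)
Notation superop R m n := 'Hom('M[R[i]]_m, 'M[R[i]]_n).

(* A bipartite system AB with dim A = a and dim B = b has dimension a * b; the
   basis vector |i>|j> has index [mxtens_index (i, j)], as in [tensmx]. *)

Section TensorProduct.
Variable R : realType.

Definition tensop_fun a b a' b' (E : superop R a a') (F : superop R b b')
    (X : 'M[R[i]]_(a * b)) : 'M[R[i]]_(a' * b') :=
  \sum_(i < a) \sum_(j < a) \sum_(k < b) \sum_(l < b)
    X (mxtens_index (i, k)) (mxtens_index (j, l)) *:
      (E (delta_mx i j) *t F (delta_mx k l)).

Definition tensop a b a' b' (E : superop R a a') (F : superop R b b') :
    superop R (a * b) (a' * b') :=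
  linfun (tensop_fun E F).

Lemma tensop_fun_is_linear a b a' b' (E : superop R a a') (F : superop R b b') :
  linear (tensop_fun E F).
Proof.
move=> c X Y; rewrite /tensop_fun.
do 4!(rewrite scaler_sumr -big_split /=; apply: eq_bigr => ? _).
by rewrite !mxE scalerDl scalerA.
Qed.

HB.instance Definition _ a b a' b' (E : superop R a a') (F : superop R b b') :=
  GRing.isLinear.Build _ _ _ _ (tensop_fun E F) (@tensop_fun_is_linear _ _ _ _ E F).

Lemma tensmx_scale m n p q (c d : R[i]) (A : 'M[R[i]]_(m, n))
    (B : 'M[R[i]]_(p, q)) :
  (c *: A) *t (d *: B) = (c * d) *: (A *t B).
Proof. by apply/matrixP => i j; rewrite !mxE mulrACA. Qed.

Lemma tensmx_suml m n p q (I : finType) (A : I -> 'M[R[i]]_(m, n))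
    (B : 'M[R[i]]_(p, q)) :
  (\sum_i A i) *t B = \sum_i (A i *t B).
Proof.
apply/matrixP => i j; rewrite summxE !mxE summxE mulr_suml.
by apply: eq_bigr => k _; rewrite mxE.
Qed.

Lemma tensmx_sumr m n p q (I : finType) (A : 'M[R[i]]_(m, n))
    (B : I -> 'M[R[i]]_(p, q)) :
  A *t (\sum_i B i) = \sum_i (A *t B i).
Proof.
apply/matrixP => i j; rewrite summxE !mxE summxE mulr_sumr.
by apply: eq_bigr => k _; rewrite mxE.
Qed.

Lemma tensopE a b a' b' (E : superop R a a') (F : superop R b b') X Y :
  tensop E F (X *t Y) = E X *t F Y.
Proof.
rewrite lfunE /= /tensop_fun.
rewrite {2}[X]matrix_sum_delta {2}[Y]matrix_sum_delta.
rewrite linear_sum tensmx_suml; apply: eq_bigr => i _.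
rewrite linear_sum tensmx_suml; apply: eq_bigr => j _.
rewrite linear_sum tensmx_sumr; apply: eq_bigr => k _.
rewrite linear_sum tensmx_sumr; apply: eq_bigr => l _.
by rewrite !linearZ /= tensmx_scale tensmxE.
Qed.

End TensorProduct.

Section QuantumMaps.
Variable R : realType.

(* In R[i], [0 <= z] states that z is a nonnegative real; Hermiticity follows. *)
Definition psd n (X : 'M[R[i]]_n) : Prop :=
  forall v : 'cV[R[i]]_n, 0 <= (v^t* *m X *m v) ord0 ord0.

Definition completely_positive m n (E : superop R m n) : Prop :=
  forall (k : nat) (X : 'M[R[i]]_(k * m)),
    psd X -> psd (tensop (\1%VF : superop R k k) E X).

Definition trace_preserving m n (E : superop R m n) : Prop :=
  forall X, \tr (E X) = \tr X.

Definition cptp m n (E : superop R m n) : Prop :=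
  completely_positive E /\ trace_preserving E.

Definition unitary_channel n (U : 'M[R[i]]_n) : superop R n n :=
  linfun (fun X => U *m X *m U^t*).

Lemma unitary_channelE n (U X : 'M[R[i]]_n) :
  unitary_channel U X = U *m X *m U^t*.
Proof. exact: (lfunE (mulmxr (U^t*) \o mulmx U)). Qed.

Definition local_op n (F : superop R n n) : Prop :=
  exists Ap Am : superop R n n,
    [/\ completely_positive Ap, completely_positive Am,
        cptp (Ap + Am) & F = Ap - Am].

Definition LO a b (F : superop R (a * b) (a * b)) : Prop :=
  exists (FA : superop R a a) (FB : superop R b b),
    [/\ local_op FA, local_op FB & F = tensop FA FB].

Definition instrument m n (I : finType) (E : I -> superop R m n) : Prop :=
  (forall i, completely_positive (E i)) /\ trace_preserving (\sum_i E i).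

Definition one_way_A a b a' b' (I : finType)
    (K : I -> superop R (a * b) (a' * b')) : Prop :=
  exists (E : I -> superop R a a') (T : I -> superop R b b'),
    [/\ instrument E, forall i, cptp (T i) & forall i, K i = tensop (E i) (T i)].

Definition one_way_B a b a' b' (I : finType)
    (K : I -> superop R (a * b) (a' * b')) : Prop :=
  exists (T : I -> superop R a a') (E : I -> superop R b b'),
    [/\ instrument E, forall i, cptp (T i) & forall i, K i = tensop (T i) (E i)].

(* Protocols as finite trees: a first round [K] is followed, for each of its
   outcomes i, by a protocol [F i] chosen according to i.  Since [F i] is itself
   such a tree, every round may depend on all previous outcomes, as may the
   intermediate local dimensions.  The final dimensions c, d are common to all
   branches, and the outcomes are the complete histories. *)
Inductive locc_protocol (c d : nat) : forall (a b : nat) (I : finType),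
    (I -> superop R (a * b) (c * d)) -> Prop :=
| locc_stop : @locc_protocol c d c d unit (fun=> \1%VF)
| locc_round (a b a' b' : nat) (I : finType)
    (K : I -> superop R (a * b) (a' * b'))
    (J : I -> finType) (F : forall i, J i -> superop R (a' * b') (c * d)) :
    one_way_A K \/ one_way_B K ->
    (forall i, locc_protocol (F i)) ->
    locc_protocol (fun h : {i : I & J i} =>
      (F (tag h) (tagged h) \o K (tag h))%VF).

(* [f] is the coarse-graining of the outcomes. *)
Definition locc_instrument a b c d (I : finType)
    (E : I -> superop R (a * b) (c * d)) : Prop :=
  exists (J : finType) (F : J -> superop R (a * b) (c * d)) (f : J -> I),
    locc_protocol F /\ forall i, E i = \sum_(j | f j == i) F j.

Definition LOCC a b (F : superop R (a * b) (a * b)) : Prop :=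
  exists (I : finType) (E : I -> superop R (a * b) (a * b)) (s : I -> bool),
    locc_instrument E /\ F = \sum_i (-1) ^+ s i *: E i.

End QuantumMaps.

Variant op_class := ClassLO | ClassLOCC.

Section Gamma.
Variable R : realType.

Definition in_class (S : op_class) a b (F : superop R (a * b) (a * b)) : Prop :=
  match S with ClassLO => LO F | ClassLOCC => LOCC F end.

Definition qpd_cost (S : op_class) a b (E : superop R (a * b) (a * b))
    (c : R) : Prop :=
  exists (m : nat) (x : 'I_m -> R) (F : 'I_m -> superop R (a * b) (a * b)),
    [/\ (1 <= m)%N, forall i, in_class S (F i),
        E = \sum_(i < m) (x i)%:C *: F i & c = \sum_(i < m) `|x i|].

(* [is_gamma S E g] says that the minimum defining the gamma-factor of E exists
   and equals g. *)
Definition is_gamma (S : op_class) a b (E : superop R (a * b) (a * b))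
    (g : R) : Prop :=
  qpd_cost S E g /\ forall c, qpd_cost S E c -> g <= c.

Lemma is_gamma_unique S a b (E : superop R (a * b) (a * b)) g h :
  is_gamma S E g -> is_gamma S E h -> g = h.
Proof.
move=> [Eg ming] [Eh minh]; apply/eqP; rewrite eq_le.
by rewrite ming // minh.
Qed.

(* The state of the k-th of n qubits in the basis state with index i < 2 ^ n. *)
Definition qubit n (k : 'I_n) (i : 'I_(2 ^ n)) : 'I_2 := inord (i %/ 2 ^ k %% 2)%N.

(* Tensor power of a two-qubit operator, regrouped so that A collects the first
   and B the second qubits of the n pairs. *)
Definition bipartite_power (U : 'M[R[i]]_(2 * 2)) (n : nat) :
    'M[R[i]]_(2 ^ n * 2 ^ n) :=
  \matrix_(r, c) \prod_(k < n)
    let: (rA, rB) := mxtens_unindex r in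
    let: (cA, cB) := mxtens_unindex c in
    U (mxtens_index (qubit k rA, qubit k rB))
      (mxtens_index (qubit k cA, qubit k cB)).

End Gamma.

(* Main.v *)
(* Write U as a sum of u_i P_i (x) Q_i with u_i >= 0, (P_i) and (Q_i) families of
   unitaries orthogonal for the trace form.  Then, for LO and LOCC alike,
   gamma(U) = 2 s^2 - 1 with s the sum of the u_i.

   Lower bound: LO and LOCC maps are signed sums of products of completely
   positive maps whose unsigned sum is trace preserving.  On the Choi states of
   such products the witness 2 |phi><phi| - 1, with phi maximally entangled in
   the bases P and Q, takes values in [-1, 1], and it equals 2 s^2 - 1 on U.
   Upper bound: the diagonal terms of the channel of U are local unitaries, and a
   cross term plus its adjoint is a difference of two products of local
   operations "real part of K . L^*".

   For two qubits, expand U in the quaternion basis, with coefficient matrix M.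
   Taking partial traces of U U^* = U^* U = 1 shows that M M^* and M^* M are real,
   so M = O1 D O2 with O1, O2 real orthogonal and D diagonal, and real orthogonal
   combinations of the quaternion units are again orthogonal unitaries.  Products
   of such decompositions have the same shape, so gamma(U^(x)n) = 2 s^(2n) - 1,
   and 2 t^n - 1 < (2 t - 1)^n for t = s^2 > 1 and n >= 2. *)

Require Import Defs.
From HB Require Import structures.
From mathcomp Require Import all_boot all_order all_algebra.
From mathcomp Require Import complex mxtens.
From mathcomp Require Import reals.
From mathcomp Require Import ring lra.

Set Implicit Arguments.
Unset Strict Implicit.
Unset Printing Implicit Defensive.

Import Order.TTheory GRing.Theory Num.Theory.
Local Open Scope ring_scope.
Local Open Scope sesquilinear_scope.

(** * Tensor products and completely positive maps *)

Lemma trmxC_mul (C : numClosedFieldType) m n p (A : 'M[C]_(m, n)) (B : 'M[C]_(n, p)) :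
  (A *m B)^t* = B^t* *m A^t*.
Proof. by rewrite trmx_mul map_mxM. Qed.

Lemma trmxCD (C : numClosedFieldType) m n (A B : 'M[C]_(m, n)) :
  (A + B)^t* = A^t* + B^t*.
Proof. by rewrite linearD map_mxD. Qed.

Lemma trmxCN (C : numClosedFieldType) m n (A : 'M[C]_(m, n)) : (- A)^t* = - A^t*.
Proof. by rewrite linearN map_mxN. Qed.

Lemma trmxCZ (C : numClosedFieldType) m n z (A : 'M[C]_(m, n)) :
  (z *: A)^t* = z^* *: A^t*.
Proof. by rewrite linearZ map_mxZ. Qed.

Lemma trmxC_sum (C : numClosedFieldType) m n (I : finType) (A : I -> 'M[C]_(m, n)) :
  (\sum_i A i)^t* = \sum_i (A i)^t*.
Proof. by rewrite linear_sum /= map_mx_sum. Qed.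

Lemma trmxC1 (C : numClosedFieldType) n : (1%:M : 'M[C]_n)^t* = 1%:M.
Proof. by rewrite trmx1 map_mx1. Qed.

Lemma trmxC_tens (C : numClosedFieldType) m n p q
    (A : 'M[C]_(m, n)) (B : 'M[C]_(p, q)) : (A *t B)^t* = A^t* *t B^t*.
Proof. by rewrite trmx_tens map_mxT. Qed.

Lemma tensmx11 (K : comPzRingType) m n : (1%:M : 'M[K]_m) *t (1%:M : 'M[K]_n) = 1%:M.
Proof.
apply/matrixP => i j.
case: (mxtens_indexP i) => i0 i1; case: (mxtens_indexP j) => j0 j1.
rewrite tensmxE !mxE -natrM mulnb; congr ((nat_of_bool _)%:R).
by rewrite (can_eq (@mxtens_indexK m n)) xpair_eqE.
Qed.

Lemma delta_mx_tens (K : comPzRingType) m n p q (i : 'I_m) (j : 'I_n) (k : 'I_p) (l : 'I_q) :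
  delta_mx (mxtens_index (i, k)) (mxtens_index (j, l)) =
  delta_mx i j *t delta_mx k l :> 'M[K]_(m * p, n * q).
Proof.
apply/matrixP => x y.
case: (mxtens_indexP x) => i0 i1; case: (mxtens_indexP y) => j0 j1.
rewrite tensmxE !mxE -natrM mulnb; congr ((nat_of_bool _)%:R).
rewrite !(can_eq (@mxtens_indexK _ _)) !xpair_eqE.
by case: eqP; case: eqP; case: eqP; case: eqP.
Qed.

Lemma sum_mxtens (V : nmodType) m n (F : 'I_(m * n) -> V) :
  \sum_i F i = \sum_i \sum_j F (mxtens_index (i, j)).
Proof.
rewrite pair_big (reindex (@mxtens_index m n)) /=.
  by apply: eq_bigr => -[].
by exists (@mxtens_unindex m n) => i _; rewrite (mxtens_indexK, mxtens_unindexK).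
Qed.

Lemma mxtrace_tens (K : comPzRingType) m n (A : 'M[K]_m) (B : 'M[K]_n) :
  \tr (A *t B) = \tr A * \tr B.
Proof.
rewrite /mxtrace sum_mxtens mulr_suml; apply: eq_bigr => i _.
by rewrite mulr_sumr; apply: eq_bigr => j _; rewrite tensmxE.
Qed.

(** Products span: each matrix unit of the composite space is itself a product of matrix units. *)
Lemma tens_ext (K : comNzRingType) a b (V : lmodType K)
    (f g : {linear 'M[K]_(a * b) -> V}) :
  (forall X Y, f (X *t Y) = g (X *t Y)) -> f =1 g.
Proof.
move=> fg X; rewrite (matrix_sum_delta X) !linear_sum; apply: eq_bigr => i _.
rewrite !linear_sum; apply: eq_bigr => j _; rewrite !linearZ /=; congr (_ *: _).
case: (mxtens_indexP i) => i0 i1; case: (mxtens_indexP j) => j0 j1.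
by rewrite delta_mx_tens fg.
Qed.

Section Superoperators.
Variable R : realType.
Local Notation C := R[i].

Lemma tensop_ext a b a' b' (F G : superop R (a * b) (a' * b')) :
  (forall X Y, F (X *t Y) = G (X *t Y)) -> F = G.
Proof. by move=> FG; apply/lfunP => X; exact: (tens_ext FG). Qed.

Lemma tensop_comp a b a' b' a'' b'' (E' : superop R a' a'') (F' : superop R b' b'')
    (E : superop R a a') (F : superop R b b') :
  tensop (E' \o E)%VF (F' \o F)%VF = (tensop E' F' \o tensop E F)%VF.
Proof. by apply: tensop_ext => X Y; rewrite comp_lfunE !tensopE !comp_lfunE. Qed.

Lemma tensop1 a b : tensop (\1%VF : superop R a a) (\1%VF : superop R b b) = \1%VF.
Proof. by apply: tensop_ext => X Y; rewrite tensopE !id_lfunE. Qed.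

Lemma tensmxDl m n p q (A A' : 'M[C]_(m, n)) (B : 'M[C]_(p, q)) :
  (A + A') *t B = A *t B + A' *t B.
Proof. by apply/matrixP => i j; rewrite !mxE mulrDl. Qed.

Lemma tensmxDr m n p q (A : 'M[C]_(m, n)) (B B' : 'M[C]_(p, q)) :
  A *t (B + B') = A *t B + A *t B'.
Proof. by apply/matrixP => i j; rewrite !mxE mulrDr. Qed.

Lemma tensmxZl m n p q z (A : 'M[C]_(m, n)) (B : 'M[C]_(p, q)) :
  (z *: A) *t B = z *: (A *t B).
Proof. by rewrite -[B in LHS]scale1r tensmx_scale mulr1. Qed.

Lemma tensmxZr m n p q z (A : 'M[C]_(m, n)) (B : 'M[C]_(p, q)) :
  A *t (z *: B) = z *: (A *t B).
Proof. by rewrite -[A in LHS]scale1r tensmx_scale mul1r. Qed.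

Lemma tensopDl a b a' b' (E E' : superop R a a') (F : superop R b b') :
  tensop (E + E') F = tensop E F + tensop E' F.
Proof.
apply: tensop_ext => X Y; apply: etrans (tensopE _ _ _ _) _.
by rewrite (add_lfunE E) (add_lfunE (tensop E F)) (tensopE E) (tensopE E') tensmxDl.
Qed.

Lemma tensopDr a b a' b' (E : superop R a a') (F F' : superop R b b') :
  tensop E (F + F') = tensop E F + tensop E F'.
Proof.
apply: tensop_ext => X Y; apply: etrans (tensopE _ _ _ _) _.
by rewrite (add_lfunE F) (add_lfunE (tensop E F)) (tensopE E F) (tensopE E F') tensmxDr.
Qed.

Lemma tensopZl a b a' b' z (E : superop R a a') (F : superop R b b') :
  tensop (z *: E) F = z *: tensop E F.
Proof.
apply: tensop_ext => X Y; apply: etrans (tensopE _ _ _ _) _.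
by rewrite (scale_lfunE z (tensop E F)) (tensopE E) (scale_lfunE z E) tensmxZl.
Qed.

Lemma tensopZr a b a' b' z (E : superop R a a') (F : superop R b b') :
  tensop E (z *: F) = z *: tensop E F.
Proof.
apply: tensop_ext => X Y; apply: etrans (tensopE _ _ _ _) _.
by rewrite (scale_lfunE z (tensop E F)) (tensopE E F) (scale_lfunE z F) tensmxZr.
Qed.

Lemma psdD n (X Y : 'M[C]_n) : psd X -> psd Y -> psd (X + Y).
Proof.
move=> pX pY v; rewrite mulmxDr mulmxDl mxE; apply: addr_ge0; [exact: pX|exact: pY].
Qed.

Lemma psdZ n z (X : 'M[C]_n) : 0 <= z -> psd X -> psd (z *: X).
Proof.
move=> z0 pX v; rewrite -scalemxAr -scalemxAl mxE; apply: mulr_ge0 => //; exact: pX.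
Qed.

Lemma psd_conj m n (K : 'M[C]_(n, m)) (X : 'M[C]_m) : psd X -> psd (K *m X *m K^t*).
Proof.
move=> pX v; have := pX (K^t* *m v).
by rewrite trmxC_mul trmxCK !mulmxA.
Qed.

Lemma psd_rank1 n (w : 'cV[C]_n) : psd (w *m w^t*).
Proof.
have p1 : psd (1%:M : 'M[C]_1).
  move=> v; rewrite mulmx1 mxE big_ord1 !mxE mulrC; exact: mul_conjC_ge0.
by have := psd_conj w p1; rewrite mulmx1.
Qed.

Lemma psd_diag n (X : 'M[C]_n) i : psd X -> 0 <= X i i.
Proof.
move=> /(_ (delta_mx i ord0)); rewrite trmx_delta map_delta_mx.
by rewrite -rowE -colE !mxE.
Qed.

Lemma cp_id n : completely_positive (\1%VF : superop R n n).
Proof. by move=> k X; rewrite tensop1 id_lfunE. Qed.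

Lemma cp_comp m n p (F : superop R n p) (E : superop R m n) :
  completely_positive F -> completely_positive E -> completely_positive (F \o E)%VF.
Proof.
move=> cF cE k X pX.
rewrite -[X in tensop X _](comp_lfun1r \1%VF) tensop_comp comp_lfunE.
exact/cF/cE.
Qed.

Lemma cpD m n (E F : superop R m n) :
  completely_positive E -> completely_positive F -> completely_positive (E + F).
Proof.
move=> cE cF k X pX; rewrite tensopDr add_lfunE.
by apply: psdD; [apply: cE|apply: cF].
Qed.

Lemma cpZ m n z (E : superop R m n) :
  0 <= z -> completely_positive E -> completely_positive (z *: E).
Proof.
move=> z0 cE k X pX; rewrite tensopZr scale_lfunE.
by apply: psdZ => //; apply: cE.
Qed.

(** For [K = L] this is the map with the single Kraus operator [K]; for [K != L] it is a cross term
    in the expansion of a unitary channel. *)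
Definition sandwich m n (K L : 'M[C]_(n, m)) : superop R m n :=
  linfun (mulmxr (L^t*) \o mulmx K).

Lemma sandwichE m n (K L : 'M[C]_(n, m)) X : sandwich K L X = K *m X *m L^t*.
Proof. by rewrite lfunE. Qed.

Lemma tensop_sandwich a b a' b' (K L : 'M[C]_(a', a)) (K' L' : 'M[C]_(b', b)) :
  tensop (sandwich K L) (sandwich K' L') = sandwich (K *t K') (L *t L').
Proof.
apply: tensop_ext => X Y.
by rewrite tensopE !sandwichE trmxC_tens !tensmx_mul.
Qed.

Lemma sandwich1 n : sandwich 1%:M 1%:M = \1%VF :> superop R n n.
Proof.
by apply/lfunP => X; rewrite sandwichE id_lfunE trmxC1 mul1mx mulmx1.
Qed.

Lemma cp_sandwich m n (K : 'M[C]_(n, m)) : completely_positive (sandwich K K).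
Proof.
by move=> k X pX; rewrite -sandwich1 tensop_sandwich sandwichE; exact: psd_conj.
Qed.

End Superoperators.

(** * LO and LOCC maps are signed separable instruments *)

Section SeparableInstruments.
Variable R : realType.
Local Notation C := R[i].

(** A relaxation of LOCC instruments that is stable under composition along a protocol tree and
    keeps exactly what the lower bound uses. *)
Definition separable_instrument a b a' b' (I : finType)
    (K : I -> superop R (a * b) (a' * b')) : Prop :=
  (forall i, exists (E : superop R a a') (G : superop R b b'),
     [/\ completely_positive E, completely_positive G & K i = tensop E G]) /\
  trace_preserving (\sum_i K i).

(** It suffices to test on [X *t Y]: each [T i] leaves the factor [\tr Y] alone, and the remaining
    factors sum to [\tr X]. *)
Lemma trace_sum_tens_A a b a' b' (I : finType) (E : I -> superop R a a')
    (T : I -> superop R b b') :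
  trace_preserving (\sum_i E i) -> (forall i, trace_preserving (T i)) ->
  trace_preserving (\sum_i tensop (E i) (T i)).
Proof.
move=> tE tT; apply: (@tens_ext _ _ _ _
  (mxtrace \o (\sum_i tensop (E i) (T i) : superop R _ _)) mxtrace) => X Y /=.
rewrite mxtrace_tens -tE !sum_lfunE !linear_sum /= mulr_suml.
by apply: eq_bigr => i _; rewrite tensopE mxtrace_tens tT.
Qed.

Lemma trace_sum_tens_B a b a' b' (I : finType) (T : I -> superop R a a')
    (E : I -> superop R b b') :
  trace_preserving (\sum_i E i) -> (forall i, trace_preserving (T i)) ->
  trace_preserving (\sum_i tensop (T i) (E i)).
Proof.
move=> tE tT; apply: (@tens_ext _ _ _ _
  (mxtrace \o (\sum_i tensop (T i) (E i) : superop R _ _)) mxtrace) => X Y /=.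
rewrite mxtrace_tens -[\tr Y]tE !sum_lfunE !linear_sum /= mulr_sumr.
by apply: eq_bigr => i _; rewrite tensopE mxtrace_tens tT.
Qed.

Lemma one_way_separable a b a' b' (I : finType) (K : I -> superop R (a * b) (a' * b')) :
  one_way_A K \/ one_way_B K -> separable_instrument K.
Proof.
case=> [[E [T [[cE tE] cT KE]]] | [T [E [[cE tE] cT KE]]]].
  split=> [i|]; first by exists (E i), (T i); split=> //; case: (cT i).
  rewrite (eq_bigr _ (fun i _ => KE i)); apply: trace_sum_tens_A => // i.
  by case: (cT i).
split=> [i|]; first by exists (T i), (E i); split=> //; case: (cT i).
rewrite (eq_bigr _ (fun i _ => KE i)); apply: trace_sum_tens_B => // i.
by case: (cT i).
Qed.

Lemma big_tagged (V : nmodType) (I : finType) (J : I -> finType)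
    (F : forall i, J i -> V) :
  \sum_(h : {i : I & J i}) F (tag h) (tagged h) = \sum_i \sum_j F i j.
Proof. by rewrite -(@sig_big_dep V 0 +%R I J xpredT (fun=> xpredT) F). Qed.

(** Induction on the protocol tree. Composites of product maps are product maps, and summing first
    over the continuations of a given outcome [i] preserves the trace of what [K i] produced. *)
Lemma locc_protocol_separable c d a b (I : finType) (F : I -> superop R (a * b) (c * d)) :
  locc_protocol F -> separable_instrument F.
Proof.
elim=> {a b I F} [|a b a' b' I K J F Kow _ IH].
  split=> [i|].
    by exists \1%VF, \1%VF; split; [exact: cp_id|exact: cp_id|rewrite tensop1].
  by rewrite big_const card_unit /= addr0 => X; rewrite id_lfunE.
have [sepK tK] := one_way_separable Kow.
split=> [[i j]|X] /=.
  have [E [G [cE cG ->]]] := sepK i; have [E' [G' [cE' cG' ->]]] := (IH i).1 j.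
  exists (E' \o E)%VF, (G' \o G)%VF.
  by split; [exact: cp_comp|exact: cp_comp|rewrite tensop_comp].
rewrite (big_tagged (fun i j => (F i j \o K i)%VF)) -tK !sum_lfunE !linear_sum /=.
apply: eq_bigr => i _; rewrite -(IH i).2 !sum_lfunE.
by congr (\tr _); apply: eq_bigr => j _; rewrite comp_lfunE.
Qed.

Definition signed_separable a b (F : superop R (a * b) (a * b)) : Prop :=
  exists (I : finType) (K : I -> superop R (a * b) (a * b)) (s : I -> bool),
    separable_instrument K /\ F = \sum_i (-1) ^+ s i *: K i.

(** Coarse-graining can be undone: every fine outcome inherits the sign of its class. *)
Lemma LOCC_signed_separable a b (F : superop R (a * b) (a * b)) :
  LOCC F -> signed_separable F.
Proof.
case=> I [E [s [[J [G [f [pG EG]]]] ->]]].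
exists J, G, (s \o f); split; first exact: locc_protocol_separable.
rewrite (partition_big f xpredT) //=; apply: eq_bigr => i _.
by rewrite EG scaler_sumr; apply: eq_bigr => j /eqP ->.
Qed.

(** A applies the instrument formed by [Ap] and [Am], B the one formed by [Bp] and [Bm], and the
    outcome is weighted by the product of the two signs. *)
Lemma LO_LOCC a b (F : superop R (a * b) (a * b)) : LO F -> LOCC F.
Proof.
case=> FA [FB [[Ap [Am [cAp cAm [_ tA] ->]]] [Bp [Bm [cBp cBm [_ tB] ->]]] ->]].
pose A s := if s then Am else Ap; pose B s := if s then Bm else Bp.
have sA : \sum_i A i = Ap + Am by rewrite big_bool addrC.
have sB : \sum_i B i = Bp + Bm by rewrite big_bool addrC.
have iA : instrument A by split; [case; [exact: cAm|exact: cAp]|rewrite sA; exact: tA].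
have iB : instrument B by split; [case; [exact: cBm|exact: cBp]|rewrite sB; exact: tB].
clear tA tB.
have cid n : cptp (\1%VF : superop R n n).
  by split=> [|X]; [exact: cp_id|rewrite id_lfunE].
pose KA s := tensop (A s) (\1%VF : superop R b b).
pose KB s := tensop (\1%VF : superop R a a) (B s).
have wA : one_way_A KA by exists A, (fun=> \1%VF); split.
have wB : one_way_B KB by exists (fun=> \1%VF), B; split.
have pB := locc_round (or_intror wB) (fun=> locc_stop R a b).
have pA := locc_round (or_introl wA) (fun=> pB).
(* The outcome [true] stands for a minus sign, so the exclusive or of the two outcomes is the
   exponent of the product of signs. *)
pose s (h : {i : bool & {j : bool & unit}}) := tag h (+) tag (tagged h).
pose K (h : {i : bool & {j : bool & unit}}) :=
  ((\1 \o KB (tag (tagged h))) \o KA (tag h))%VF.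
have KE i j : ((\1 \o KB j) \o KA i)%VF = tensop (A i) (B j).
  by rewrite comp_lfun1l /KB /KA -(tensop_comp \1 (B j)) comp_lfun1l comp_lfun1r.
exists {i : bool & {j : bool & unit}}, K, s; split.
  exists {i : bool & {j : bool & unit}}, K, id; split; first exact: pA.
  by move=> i; rewrite big_pred1_eq.
rewrite (big_tagged (fun i (h : {j : bool & unit}) =>
  (-1) ^+ (i (+) tag h) *: ((\1 \o KB (tag h)) \o KA i)%VF)).
have E1 i : \sum_(h : {j : bool & unit})
    (-1) ^+ (i (+) tag h) *: ((\1 \o KB (tag h)) \o KA i)%VF =
    (-1) ^+ (i (+) true) *: tensop (A i) Bm + (-1) ^+ (i (+) false) *: tensop (A i) Bp.
  rewrite (big_tagged (fun j (_ : unit) =>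
    (-1) ^+ (i (+) j) *: ((\1 \o KB j) \o KA i)%VF)).
  by rewrite big_bool; congr (_ + _); rewrite big_const card_unit /= addr0 KE.
rewrite (eq_bigr _ (fun i _ => E1 i)) big_bool /A /= expr0 expr1.
rewrite (scale1r (tensop Ap Bp)) (scale1r (tensop Am Bm)).
rewrite -[- Am]scaleN1r -[- Bm]scaleN1r tensopDl !tensopDr !tensopZl !tensopZr.
by rewrite scalerA mulrNN mulr1 scale1r [RHS]addrC; congr (_ + _); rewrite addrC.
Qed.

Lemma in_class_signed_separable S a b (F : superop R (a * b) (a * b)) :
  in_class S F -> signed_separable F.
Proof. by case: S => [/LO_LOCC|]; exact: LOCC_signed_separable. Qed.

End SeparableInstruments.

(** * Positive matrices and Choi matrices *)

Lemma delta_form (C : numClosedFieldType) m n (X : 'M[C]_(m, n)) i j :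
  ((delta_mx i 0 : 'cV_m)^t* *m X *m (delta_mx j 0 : 'cV_n)) 0 0 = X i j.
Proof. by rewrite trmx_delta map_delta_mx -rowE -colE !mxE. Qed.

(** Polarization: on [e_i + z e_j], the choices [z = 1] and [z = 'i] show that the sum and the
    difference of [Y i j] and [Y j i] vanish. *)
Lemma form_eq0 (C : numClosedFieldType) n (Y : 'M[C]_n) :
  (forall v : 'cV[C]_n, (v^t* *m Y *m v) 0 0 = 0) -> Y = 0.
Proof.
move=> Y0.
have pol z i j : z * Y i j + z^* * Y j i = 0.
  have := Y0 (delta_mx i 0 + z *: delta_mx j 0).
  rewrite trmxCD trmxCZ !mulmxDl !mulmxDr -!scalemxAl -!scalemxAr.
  have mE (A B : 'M[C]_1) : (A + B) 0 0 = A 0 0 + B 0 0 by rewrite mxE.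
  have sE c (A : 'M[C]_1) : (c *: A) 0 0 = c * A 0 0 by rewrite mxE.
  by rewrite !mE !sE !Y0 !delta_form !mulr0 !(add0r, addr0).
apply/matrixP => i j; rewrite [RHS]mxE.
have := pol 1 i j; have := pol 'i i j; rewrite conjCi conjC1 !mul1r mulNr -mulrBr.
move/eqP; rewrite mulf_eq0 (negbTE (neq0Ci C)) subr_eq0 => /eqP ->.
by rewrite -mulr2n => /eqP; rewrite mulrn_eq0 /= => /eqP.
Qed.

Section PositiveMatrices.
Variable R : realType.
Local Notation C := R[i].

(** The quadratic form of [X] takes real values, so that of [X^t* - X] is zero. *)
Lemma psd_trC n (X : 'M[C]_n) : psd X -> X^t* = X.
Proof.
move=> pX; apply/eqP; rewrite -subr_eq0; apply/eqP/form_eq0 => v.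
rewrite mulmxBr mulmxBl.
have -> : v^t* *m X^t* *m v = (v^t* *m X *m v)^t*.
  by rewrite !trmxC_mul trmxCK mulmxA.
by rewrite mxE [X in X + _]mxE [X in X^* + _]mxE [X in _ + X]mxE geC0_conj ?subrr //; exact: pX.
Qed.

Lemma psd_tr_ge0 n (X : 'M[C]_n) : psd X -> 0 <= \tr X.
Proof. by move=> pX; apply: sumr_ge0 => i _; exact: psd_diag. Qed.

(** Bessel's inequality: [V *m V^t*] is [c] times an orthogonal projection, and [D] is [c] times the
    complementary one, on which [X] has nonnegative trace. *)
Lemma psd_bessel n N c (X : 'M[C]_n) (V : 'M[C]_(n, N)) :
  psd X -> 0 < c -> V^t* *m V = c%:M -> \tr (V^t* *m X *m V) <= c * \tr X.
Proof.
move=> pX c0 VV; pose D : 'M[C]_n := c%:M - V *m V^t*.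
have cc : c^* = c by rewrite geC0_conj ?ltW.
have DD : D *m D^t* = c *: D.
  have DV : D *m V = 0.
    by rewrite mulmxBl -mulmxA VV mul_scalar_mx mul_mx_scalar subrr.
  rewrite trmxCD trmxCN trmxC_mul trmxCK tr_scalar_mx map_scalar_mx /= cc.
  by rewrite mulmxBr mulmxA DV mul0mx subr0 mul_mx_scalar.
have : 0 <= \tr (D^t* *m X *m D).
  by apply: psd_tr_ge0; rewrite -{2}(trmxCK D); exact: psd_conj.
rewrite mxtrace_mulC mulmxA DD -scalemxAl mxtraceZ pmulr_rge0 //.
rewrite mulmxBl mul_scalar_mx linearB /= mxtraceZ subr_ge0.
by rewrite (mxtrace_mulC _ V) mulmxA.
Qed.

Lemma psd_spectral n (X : 'M[C]_n) : psd X ->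
  exists2 W : 'M[C]_n, W \is unitarymx &
    exists2 d : 'rV[C]_n, forall k, 0 <= d 0 k & X = W^t* *m diag_mx d *m W.
Proof.
move=> pX; have nX : X \is normalmx by apply/normalmxP; rewrite psd_trC.
have /orthomx_spectralP XE := nX.
have uW := spectral_unitarymx X; rewrite invmx_unitary // in XE.
set W := spectralmx X in uW XE *; set d := spectral_diag X in XE *.
exists W => //; exists d => // k.
have /psd_diag : psd (W *m X *m W^t*) by exact: psd_conj.
move=> /(_ k); rewrite XE !mulmxA (unitarymxP _) // mul1mx mulmxtVK //.
by rewrite mxE eqxx mulr1n.
Qed.

(** Diagonalizing [Y] turns the entrywise pairing into a sum of the values of the form of [X] at
    unit vectors, weighted by the eigenvalues of [Y]. Each such value lies between 0 and [\tr X]. *)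
Lemma psd_prod_bounds n (X Y : 'M[C]_n) : psd X -> psd Y ->
  0 <= \sum_i \sum_j X i j * Y i j <= \tr X * \tr Y.
Proof.
move=> pX pY; have [W uW [d d0 YE]] := psd_spectral pY.
have -> : \tr Y = \sum_k d 0 k.
  by rewrite YE mxtrace_mulC mulmxA (unitarymxP _) // mul1mx mxtrace_diag.
pose w k : 'cV[C]_n := \col_j W k j.
have -> : \sum_i \sum_j X i j * Y i j =
    \sum_k d 0 k * ((w k)^t* *m X *m w k) 0 0.
  under [RHS]eq_bigr => k _.
    rewrite mxE mulr_sumr; under eq_bigr => j _.
      rewrite mxE mulr_suml mulr_sumr; over.
    over.
  rewrite [RHS]exchange_big /= [RHS](eq_bigr _ (fun j _ => exchange_big _ _ _ _ _ _)).
  rewrite exchange_big; apply: eq_bigr => j _; apply: eq_bigr => i _ /=.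
  rewrite YE mul_mx_diag [in LHS]mxE mulr_sumr; apply: eq_bigr => k _.
  by rewrite !mxE; ring.
rewrite mulr_sumr sumr_ge0 /= => [|k _]; last by apply: mulr_ge0 => //; exact: pX.
apply: ler_sum => k _; rewrite mulrC; apply: ler_wpM2r => //.
have := @psd_bessel _ _ 1 X (w k) pX ltr01; rewrite mul1r trace_mx11; apply.
apply/matrixP => i j; rewrite !ord1 {i j}.
move/unitarymxP: uW => /matrixP /(_ k k); rewrite !mxE eqxx => <-.
by apply: eq_bigr => j _; rewrite !mxE mulrC.
Qed.

End PositiveMatrices.

Section ChoiForm.
Variable R : realType.
Local Notation C := R[i].

(* [choi_form E P P'] is <<P|J(E)|P'>> for J(E) the Choi matrix of E. *)
Definition choi_form m n (E : superop R m n) (P P' : 'M[C]_(n, m)) : C :=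
  \sum_k \sum_l (P^t* *m E (delta_mx k l) *m P') k l.

Definition choi m n (E : superop R m n) : 'M[C]_(m * n) :=
  \matrix_(x, y) E (delta_mx (mxtens_unindex x).1 (mxtens_unindex y).1)
    (mxtens_unindex x).2 (mxtens_unindex y).2.

Definition vectorize m n (P : 'M[C]_(n, m)) : 'cV[C]_(m * n) :=
  \col_x P (mxtens_unindex x).2 (mxtens_unindex x).1.

Lemma choiE m n (E : superop R m n) :
  choi E = \sum_k \sum_l delta_mx k l *t E (delta_mx k l).
Proof.
apply/matrixP => x y; case: (mxtens_indexP x) => k p; case: (mxtens_indexP y) => l q.
rewrite mxE !mxtens_indexK summxE (bigD1 k) //= summxE (bigD1 l) //= tensmxE mxE !eqxx.
rewrite mul1r big1 ?addr0 => [|l' nl]; last first.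
  by rewrite tensmxE mxE eqxx (eq_sym l) (negbTE nl) mul0r.
rewrite big1 ?addr0 // => k' nk; rewrite summxE big1 // => l' _.
by rewrite tensmxE mxE (eq_sym k) (negbTE nk) mul0r.
Qed.

(** The Choi matrix is the image under [tensop \1 E] of the rank one matrix of [w], the unnormalized
    maximally entangled vector. *)
Lemma choi_psd m n (E : superop R m n) : completely_positive E -> psd (choi E).
Proof.
move=> cE; pose w : 'cV[C]_(m * m) := \col_x ((mxtens_unindex x).1 == (mxtens_unindex x).2)%:R.
have := cE m _ (psd_rank1 w).
have -> : w *m w^t* = \sum_k \sum_l delta_mx k l *t delta_mx k l.
  apply/matrixP => x y.
  case: (mxtens_indexP x) => k p; case: (mxtens_indexP y) => l q.
  rewrite mxE big_ord1 !mxE !mxtens_indexK /= conjC_nat.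
  rewrite summxE (bigD1 k) //= summxE (bigD1 l) //= tensmxE !mxE !eqxx mul1r.
  rewrite big1 ?addr0 => [|l' nl]; last first.
    by rewrite tensmxE mxE eqxx (eq_sym l) (negbTE nl) mul0r.
  rewrite big1 ?addr0 => [|k' nk].
    by rewrite -natrM mulnb (eq_sym k) (eq_sym l).
  rewrite summxE big1 // => l' _.
  by rewrite tensmxE mxE (eq_sym k) (negbTE nk) mul0r.
suff -> : choi E = tensop \1%VF E (\sum_k \sum_l delta_mx k l *t delta_mx k l) by [].
rewrite choiE linear_sum; apply: eq_bigr => k _; rewrite linear_sum.
by apply: eq_bigr => l _; rewrite /= tensopE id_lfunE.
Qed.

Lemma choi_trace m n (E : superop R m n) : \tr (choi E) = \tr (E 1%:M).
Proof.
have -> : 1%:M = \sum_k delta_mx k k :> 'M[C]_m by rewrite mx1_sum_delta.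
rewrite !linear_sum /= /mxtrace sum_mxtens; apply: eq_bigr => k _.
by apply: eq_bigr => p _; rewrite mxE !mxtens_indexK.
Qed.

Lemma choi_formE m n (E : superop R m n) P P' :
  choi_form E P P' = ((vectorize P)^t* *m choi E *m vectorize P') 0 0.
Proof.
rewrite mxE sum_mxtens /choi_form exchange_big /=; apply: eq_bigr => l _.
under [RHS]eq_bigr => q _ do rewrite mxE sum_mxtens mulr_suml.
rewrite [RHS]exchange_big /=; apply: eq_bigr => k _.
rewrite mxE; apply: eq_bigr => q _; rewrite mxE [vectorize _ _ _]mxE !mxtens_indexK.
by congr (_ * _); apply: eq_bigr => p _; rewrite !mxE !mxtens_indexK.
Qed.

Lemma vectorize_dot m n (P P' : 'M[C]_(n, m)) :
  ((vectorize P)^t* *m vectorize P') 0 0 = \tr (P^t* *m P').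
Proof.
rewrite mxE sum_mxtens; apply: eq_bigr => k _; rewrite mxE; apply: eq_bigr => p _.
by rewrite !mxE !mxtens_indexK.
Qed.

Lemma choi_form_tens a b a' b' (E : superop R a a') (F : superop R b b') P P' Q Q' :
  choi_form (tensop E F) (P *t Q) (P' *t Q') = choi_form E P P' * choi_form F Q Q'.
Proof.
rewrite /choi_form sum_mxtens mulr_suml; apply: eq_bigr => k _.
rewrite mulr_sumr; apply: eq_bigr => k' _.
rewrite sum_mxtens mulr_suml; apply: eq_bigr => l _.
rewrite mulr_sumr; apply: eq_bigr => l' _.
by rewrite delta_mx_tens tensopE trmxC_tens !tensmx_mul tensmxE.
Qed.

(** The Choi matrix of conjugation by [W] has rank one, spanned by [vectorize W], so its form
    factorizes. *)
Lemma choi_form_sandwich m n (W P P' : 'M[C]_(n, m)) :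
  choi_form (sandwich W W) P P' = \tr (P^t* *m W) * (\tr (P'^t* *m W))^*.
Proof.
rewrite /choi_form /mxtrace rmorph_sum mulr_suml; apply: eq_bigr => k _.
rewrite mulr_sumr; apply: eq_bigr => l _.
have -> : P^t* *m sandwich W W (delta_mx k l) *m P' =
    (P^t* *m W *m delta_mx k 0) *m (delta_mx (0 : 'I_1) l *m (W^t* *m P')).
  by rewrite sandwichE -(mul_delta_mx (0 : 'I_1)) !mulmxA.
rewrite mxE big_ord1 -colE -rowE [col _ _ _ _]mxE [row _ _ _ _]mxE.
congr (_ * _); have -> : W^t* *m P' = (P'^t* *m W)^t* by rewrite trmxC_mul trmxCK.
by rewrite mxE [X in X^*]mxE.
Qed.

End ChoiForm.

(** * The lower bound *)

Section GramBounds.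
Variable R : realType.
Local Notation C := R[i].

(** The matrix is the compression of the Choi matrix to the orthogonal vectors [vectorize (P i)];
    [psd_bessel] bounds its trace. *)
Lemma choi_gram m n (E : superop R m n) (I : finType) (P : I -> 'M[C]_(n, m)) (c : C) :
  completely_positive E -> 0 < c ->
  (forall i j, \tr ((P i)^t* *m P j) = c *+ (i == j)) ->
  exists X : 'M[C]_#|I|, [/\ psd X, \tr X <= c * \tr (E 1%:M) &
    forall i j, X i j = choi_form E (P (enum_val i)) (P (enum_val j))].
Proof.
move=> cE c0 oP; pose V : 'M[C]_(m * n, #|I|) := \matrix_(x, i) vectorize (P (enum_val i)) x 0.
have colV i : V *m (delta_mx i 0 : 'cV_#|I|) = vectorize (P (enum_val i)).
  by rewrite -colE; apply/colP => x; rewrite !mxE.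
exists (V^t* *m choi E *m V); split.
- by rewrite -{2}(trmxCK V); apply: psd_conj; exact: choi_psd.
- rewrite -choi_trace; apply: psd_bessel => //; first exact: choi_psd.
  apply/matrixP => i j; rewrite -[LHS]delta_form !mulmxA -trmxC_mul -mulmxA.
  by rewrite !colV vectorize_dot oP mxE (inj_eq enum_val_inj).
move=> i j; rewrite -[LHS]delta_form !mulmxA -trmxC_mul -mulmxA !colV.
by rewrite choi_formE.
Qed.

Lemma sum_enum_val (V : nmodType) (I : finType) (F : I -> V) :
  \sum_i F i = \sum_(i < #|I|) F (enum_val i).
Proof. by rewrite (reindex _ (onW_bij _ (@enum_val_bij I))). Qed.

Variables (a b : nat) (I : finType).
Variables (P : I -> 'M[C]_a) (Q : I -> 'M[C]_b).
Hypotheses (a_gt0 : (0 < a)%N) (b_gt0 : (0 < b)%N).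
Hypothesis oP : forall i j, \tr ((P i)^t* *m P j) = a%:R *+ (i == j).
Hypothesis oQ : forall i j, \tr ((Q i)^t* *m Q j) = b%:R *+ (i == j).

(** The Choi form of [F] at the vectorization of the sum of the [P i *t Q i], an unnormalized
    maximally entangled vector. *)
Definition overlap (F : superop R (a * b) (a * b)) : C :=
  \sum_i \sum_j choi_form F (P i *t Q i) (P j *t Q j).

(** On a product the Choi form factorizes, so the overlap is the entrywise pairing of two positive
    matrices and [psd_prod_bounds] applies. *)
Lemma overlap_tensop_bounds (E : superop R a a) (G : superop R b b) :
  completely_positive E -> completely_positive G ->
  0 <= overlap (tensop E G) <= (a * b)%:R * \tr (tensop E G 1%:M).
Proof.
move=> cE cG.
have [|X [pX tX XE]] := choi_gram cE _ oP; first by rewrite ltr0n.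
have [|Y [pY tY YE]] := choi_gram cG _ oQ; first by rewrite ltr0n.
have -> : overlap (tensop E G) = \sum_i \sum_j X i j * Y i j.
  rewrite /overlap sum_enum_val; apply: eq_bigr => i _.
  rewrite sum_enum_val; apply: eq_bigr => j _.
  by rewrite XE YE choi_form_tens.
have /andP[-> /= h] := psd_prod_bounds pX pY; apply: le_trans h _.
rewrite -tensmx11 tensopE mxtrace_tens natrM mulrACA.
by apply: ler_pM => //; exact: psd_tr_ge0.
Qed.

(* The entanglement witness 2 |phi><phi| - 1, for phi maximally entangled in the
   bases P and Q, evaluated on the (unnormalized) Choi state of F. *)
Definition witness (F : superop R (a * b) (a * b)) : C :=
  overlap F *+ 2 - (a * b)%:R * \tr (F 1%:M).

Lemma choi_form_sumZ m n (J : finType) (x : J -> C) (F : J -> superop R m n) K L :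
  choi_form (\sum_j x j *: F j) K L = \sum_j x j * choi_form (F j) K L.
Proof.
rewrite /choi_form; under [RHS]eq_bigr do rewrite mulr_sumr.
rewrite [RHS]exchange_big; apply: eq_bigr => k _ /=.
under [RHS]eq_bigr do rewrite mulr_sumr.
rewrite [RHS]exchange_big; apply: eq_bigr => l _ /=.
rewrite sum_lfunE mulmx_sumr mulmx_suml summxE; apply: eq_bigr => j _.
by rewrite scale_lfunE -scalemxAr -scalemxAl mxE.
Qed.

Lemma witness_sumZ (J : finType) (x : J -> C) (F : J -> superop R (a * b) (a * b)) :
  witness (\sum_j x j *: F j) = \sum_j x j * witness (F j).
Proof.
under [RHS]eq_bigr do rewrite mulrBr mulrnAr mulrCA.
rewrite sumrB sumrMnl -mulr_sumr; congr (_ *+ _ - _ * _); last first.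
  rewrite sum_lfunE linear_sum; apply: eq_bigr => j _.
  by rewrite scale_lfunE linearZ.
rewrite /overlap; under eq_bigr do under eq_bigr do rewrite choi_form_sumZ.
under [RHS]eq_bigr do rewrite mulr_sumr.
rewrite [RHS]exchange_big; apply: eq_bigr => i _ /=.
under [RHS]eq_bigr do rewrite mulr_sumr.
by rewrite [RHS]exchange_big.
Qed.

Lemma witness_tensop_le (E : superop R a a) (G : superop R b b) :
  completely_positive E -> completely_positive G ->
  `|witness (tensop E G)| <= (a * b)%:R * \tr (tensop E G 1%:M).
Proof.
move=> cE cG; have /andP[h0 h1] := overlap_tensop_bounds cE cG; rewrite /witness.
set t := _ * \tr _ in h1 *; set o := overlap _ in h0 h1 *.
have t0 : 0 <= t by exact: le_trans h0 h1.
have rw : o *+ 2 - t \is Num.real.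
  by apply: realB; [apply/ger0_real/mulrn_wge0|exact: ger0_real].
rewrite real_ler_norml // lerBrDl subrr lerBlDr -mulr2n lerMn2r h1 orbT andbT.
exact: mulrn_wge0.
Qed.

(** Triangle inequality over the outcomes. Trace preservation makes the individual bounds add up to
    [(a * b) * \tr 1]. *)
Lemma witness_signed_separable F :
  signed_separable F -> `|witness F| <= (a * b)%:R ^+ 2.
Proof.
case=> J [K [s [[sepK tK] ->]]]; rewrite witness_sumZ.
apply: le_trans (ler_norm_sum _ _ _) _.
have <- : \sum_j (a * b)%:R * \tr (K j 1%:M) = (a * b)%:R ^+ 2 :> C.
  rewrite -mulr_sumr expr2; congr (_ * _).
  by rewrite -[RHS]mxtrace1 -[RHS]tK sum_lfunE linear_sum.
apply: ler_sum => j _; rewrite normrM normrX normrN1 expr1n mul1r.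
by have [E [G [cE cG ->]]] := sepK j; exact: witness_tensop_le.
Qed.

End GramBounds.

(** * The upper bound *)

Lemma half_double (K : numFieldType) (x : K) : 2^-1 * (x + x) = x.
Proof. by field. Qed.

Lemma scale_half_double (K : numFieldType) (V : lmodType K) (x : V) : 2^-1 *: (x + x) = x.
Proof. by rewrite -mulr2n -scaler_nat scalerA mulVf ?scale1r ?pnatr_eq0. Qed.

Lemma quarter_sum (K : numFieldType) (V : lmodType K) (p q : V) :
  4^-1 *: (p + q) + 4^-1 *: (p - q) = 2^-1 *: p.
Proof.
rewrite -scalerDr addrACA subrr addr0 -mulr2n -scaler_nat scalerA.
by congr (_ *: _); field.
Qed.

Lemma quarter_diff (K : numFieldType) (V : lmodType K) (p q : V) :
  4^-1 *: (p + q) - 4^-1 *: (p - q) = 2^-1 *: q.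
Proof. by rewrite -scalerN opprB (addrC p) quarter_sum. Qed.

Lemma add_sub_regroup (V : zmodType) (x y z w : V) :
  x + y + (z + w) = (x + w) + (y + z) /\ x - y - (z - w) = (x + w) - (y + z).
Proof. by rewrite opprB opprD (addrC z) addrACA; split=> //; rewrite addrACA. Qed.

Section GammaFormula.
Variable R : realType.
Local Notation C := R[i].

Lemma qpd_cost_fin S a b (E : superop R (a * b) (a * b)) (J : finType)
    (x : J -> R) (F : J -> superop R (a * b) (a * b)) :
  (0 < #|J|)%N -> (forall j, in_class S (F j)) ->
  E = \sum_j (x j)%:C%C *: F j -> qpd_cost S E (\sum_j `|x j|).
Proof.
move=> J0 FS ->; exists #|J|, (x \o enum_val), (F \o enum_val); split=> //.
- by move=> i; exact: FS.
- by rewrite sum_enum_val.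
- by rewrite sum_enum_val.
Qed.

Lemma LO_in_class S a b (F : superop R (a * b) (a * b)) : LO F -> in_class S F.
Proof. by case: S => //; exact: LO_LOCC. Qed.

Lemma sandwichDl m n (K K' L : 'M[C]_(n, m)) :
  sandwich (K + K') L = sandwich K L + sandwich K' L.
Proof. by apply/lfunP => X; rewrite add_lfunE !sandwichE !mulmxDl. Qed.

Lemma sandwichDr m n (K L L' : 'M[C]_(n, m)) :
  sandwich K (L + L') = sandwich K L + sandwich K L'.
Proof. by apply/lfunP => X; rewrite add_lfunE !sandwichE trmxCD mulmxDr. Qed.

Lemma sandwichZl m n z (K L : 'M[C]_(n, m)) : sandwich (z *: K) L = z *: sandwich K L.
Proof. by apply/lfunP => X; rewrite scale_lfunE !sandwichE -!scalemxAl. Qed.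

Lemma sandwichZr m n z (K L : 'M[C]_(n, m)) : sandwich K (z *: L) = z^* *: sandwich K L.
Proof. by apply/lfunP => X; rewrite scale_lfunE !sandwichE trmxCZ -scalemxAr. Qed.

Lemma sandwich_suml m n (I : finType) (K : I -> 'M[C]_(n, m)) L :
  sandwich (\sum_i K i) L = \sum_i sandwich (K i) L.
Proof.
apply/lfunP => X; rewrite sum_lfunE sandwichE !mulmx_suml.
by apply: eq_bigr => i _; rewrite sandwichE.
Qed.

Lemma sandwich_sumr m n (I : finType) K (L : I -> 'M[C]_(n, m)) :
  sandwich K (\sum_i L i) = \sum_i sandwich K (L i).
Proof.
apply/lfunP => X; rewrite sum_lfunE sandwichE trmxC_sum !mulmx_sumr.
by apply: eq_bigr => i _; rewrite sandwichE.
Qed.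

Lemma sandwich_unitary_tp n (K : 'M[C]_n) :
  K \is unitarymx -> trace_preserving (sandwich K K).
Proof.
move=> /unitarymxP uK X; rewrite sandwichE mxtrace_mulC mulmxA.
by rewrite (mulmx1C uK) mul1mx.
Qed.

Definition real_part n (K L : 'M[C]_n) : superop R n n :=
  2^-1 *: (sandwich K L + sandwich L K).

(** Polarization: a quarter of conjugation by [K + L] minus a quarter of conjugation by [K - L] is
    the real part, while their sum is the average of two unitary conjugations. *)
Lemma real_part_local n (K L : 'M[C]_n) :
  K \is unitarymx -> L \is unitarymx -> local_op (real_part K L).
Proof.
move=> uK uL.
have q0 : 0 <= 4^-1 :> C by rewrite invr_ge0 ler0n.
pose p := sandwich K K + sandwich L L; pose q := sandwich K L + sandwich L K.
have [plusE minusE] :=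
  add_sub_regroup (sandwich K K) (sandwich K L) (sandwich L K) (sandwich L L).
have sN (A B : 'M[C]_n) : sandwich (- A) B = - sandwich A B.
  by rewrite -scaleN1r sandwichZl scaleN1r.
have sN' (A B : 'M[C]_n) : sandwich A (- B) = - sandwich A B.
  by rewrite -scaleN1r sandwichZr rmorphN1 scaleN1r.
have EP : sandwich (K + L) (K + L) = p + q.
  by rewrite sandwichDl !sandwichDr.
have EM : sandwich (K - L) (K - L) = p - q.
  by rewrite sandwichDl !sandwichDr !sN !sN' -opprD -minusE.
have cP : completely_positive (4^-1 *: (p + q)) by rewrite -EP; exact: cpZ q0 (cp_sandwich _).
have cM : completely_positive (4^-1 *: (p - q)) by rewrite -EM; exact: cpZ q0 (cp_sandwich _).
exists (4^-1 *: (p + q)), (4^-1 *: (p - q)); rewrite quarter_diff.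
split; [exact: cP|exact: cM|split; first exact: cpD|reflexivity].
move=> X; rewrite quarter_sum scale_lfunE add_lfunE mxtraceZ mxtraceD.
by rewrite (sandwich_unitary_tp uK) (sandwich_unitary_tp uL) half_double.
Qed.

(** The superoperator form of Re(zw) = Re z Re w - Im z Im w, with Re(iz) = - Im z; the two minus
    signs cancel in the product. *)
Lemma real_part_tens a b (K L : 'M[C]_a) (K' L' : 'M[C]_b) :
  tensop (real_part K L) (real_part K' L') -
    tensop (real_part ('i *: K) L) (real_part ('i *: K') L') =
  2^-1 *: (sandwich (K *t K') (L *t L') + sandwich (L *t L') (K *t K')).
Proof.
have imE n (A B : 'M[C]_n) :
    real_part ('i *: A) B = (2^-1 * 'i) *: (sandwich A B - sandwich B A).
  by rewrite /real_part sandwichZl sandwichZr conjCi scaleNr -scalerBr scalerA.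
have tN (A : superop R a a) (B : superop R b b) : tensop (- A) B = - tensop A B.
  by rewrite -scaleN1r tensopZl scaleN1r.
have tN' (A : superop R a a) (B : superop R b b) : tensop A (- B) = - tensop A B.
  by rewrite -scaleN1r tensopZr scaleN1r.
have c1 : 2^-1 * 2^-1 = 4^-1 :> C by field.
have c2 : (2^-1 * 'i) * (2^-1 * 'i) = - 4^-1 :> C.
  by rewrite mulrACA c1 -expr2 sqrCi mulrN1.
rewrite !imE /real_part.
rewrite !tensopZl !tensopZr !scalerA c1 c2 scaleNr opprK.
rewrite !tensopDl !tensopDr !tN !tN' !tensop_sandwich -opprD.
have [plusE minusE] := add_sub_regroup (sandwich (K *t K') (L *t L'))
  (sandwich (K *t L') (L *t K')) (sandwich (L *t K') (K *t L'))
  (sandwich (L *t L') (K *t K')).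
by rewrite plusE minusE; exact: quarter_sum.
Qed.

End GammaFormula.

(** * The gamma-factor from a Schmidt decomposition into orthogonal unitaries *)

Section SchmidtGamma.
Variable R : realType.
Local Notation C := R[i].

Lemma sum_diag_split (V : nmodType) (I : finType) (f : I -> I -> V) :
  \sum_i \sum_j f i j = \sum_i f i i + \sum_i \sum_j f i j *+ (i != j).
Proof.
rewrite -big_split; apply: eq_bigr => i _ /=.
rewrite (bigD1 i) //= [in RHS](bigD1 i) //= eqxx add0r; congr (_ + _).
by apply: eq_bigr => j; rewrite eq_sym => ->.
Qed.

Lemma sum_triple (V : nmodType) (I : finType) (f : I -> I -> bool -> V) :
  \sum_(p : (I * I) * bool) f p.1.1 p.1.2 p.2 =
  \sum_i \sum_j (f i j true + f i j false).
Proof.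
rewrite -(pair_bigA _ (fun (p : I * I) s => f p.1 p.2 s)).
rewrite -(pair_bigA _ (fun i j => \sum_s f i j s)).
by apply: eq_bigr => i _; apply: eq_bigr => j _; rewrite big_bool.
Qed.

Lemma real_part_diag n (K : 'M[C]_n) : real_part K K = sandwich K K.
Proof. exact: scale_half_double. Qed.

Lemma unitary_channel_sandwich n (K : 'M[C]_n) : unitary_channel K = sandwich K K.
Proof. by apply/lfunP => X; exact: etrans (unitary_channelE _ _) (esym (sandwichE _ _ _)). Qed.

Lemma unitarymxZ n (K : 'M[C]_n) z : `|z| = 1 -> K \is unitarymx -> z *: K \is unitarymx.
Proof.
move=> z1 /unitarymxP uK; apply/unitarymxP.
by rewrite trmxCZ -scalemxAl -scalemxAr scalerA uK -normCK z1 expr1n scale1r.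
Qed.

Variables (a b : nat) (I : finType) (u : I -> R).
Variables (P : I -> 'M[C]_a) (Q : I -> 'M[C]_b).
Hypotheses (a_gt0 : (0 < a)%N) (b_gt0 : (0 < b)%N).
Hypotheses (uP : forall i, P i \is unitarymx) (uQ : forall i, Q i \is unitarymx).
Hypothesis oP : forall i j, \tr ((P i)^t* *m P j) = a%:R *+ (i == j).
Hypothesis oQ : forall i j, \tr ((Q i)^t* *m Q j) = b%:R *+ (i == j).
Hypotheses (u_ge0 : forall i, 0 <= u i) (u_norm : \sum_i u i ^+ 2 = 1).

Let W : 'M[C]_(a * b) := \sum_i (u i)%:C%C *: (P i *t Q i).
Let T i j := sandwich (P i *t Q i) (P j *t Q j).

Lemma schmidt_channelE :
  unitary_channel W = \sum_i \sum_j (u i * u j)%:C%C *: T i j.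
Proof.
rewrite unitary_channel_sandwich /W sandwich_suml; apply: eq_bigr => i _.
rewrite sandwich_sumr; apply: eq_bigr => j _.
rewrite sandwichZl sandwichZr scalerA rmorphM; congr ((_ * _) *: _).
exact: conjc_real.
Qed.

Lemma sum_sqrE : (\sum_i u i) ^+ 2 = 1 + \sum_i \sum_j (u i * u j) *+ (i != j).
Proof.
rewrite -u_norm -(sum_diag_split (fun i j => u i * u j)) expr2 mulr_suml.
by apply: eq_bigr => i _; rewrite mulr_sumr.
Qed.

(** Diagonal terms cost [u i ^+ 2], in total 1. Each ordered pair [i != j] costs [2 * u i * u j], in
    total twice [(\sum_i u i) ^+ 2 - 1]. *)
Lemma gamma_upper S : qpd_cost S (unitary_channel W) (2 * (\sum_i u i) ^+ 2 - 1).
Proof.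
(* Indices [inl i] are the diagonal terms. The indices [inr (i, j, s)] are the two products of
   [real_part_tens]: [s = true] carries the minus sign and the phase ['i]. For [i = j] their weight
   is zero. *)
pose J := (I + (I * I) * bool)%type.
pose z (s : bool) : C := if s then 'i else 1.
pose w i j := (u i * u j) *+ (i != j).
pose x (h : J) := match h with
  | inl i => u i * u i | inr p => (-1) ^+ p.2 * w p.1.1 p.1.2 end.
pose G i j s := tensop (real_part (z s *: P i) (P j)) (real_part (z s *: Q i) (Q j)).
pose F (h : J) := match h with
  | inl i => G i i false | inr p => G p.1.1 p.1.2 p.2 end.
have w0 i j : 0 <= w i j by rewrite mulrn_wge0 ?mulr_ge0.
have -> : 2 * (\sum_i u i) ^+ 2 - 1 = \sum_h `|x h|.
  rewrite big_sumType /= [X in _ = X + _](eq_bigr (fun i => u i ^+ 2)) => [|i _]; last first.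
    by rewrite ger0_norm // mulr_ge0.
  rewrite u_norm (sum_triple (fun i j s => `|(-1) ^+ s * w i j|)) sum_sqrE.
  rewrite (_ : \sum_i \sum_j (_ + _) = \sum_i \sum_j w i j *+ 2); last first.
    apply: eq_bigr => i _; apply: eq_bigr => j _; rewrite !normrM !normrX.
    by rewrite normrN1 !expr1n !mul1r ger0_norm.
  under [in RHS]eq_bigr do rewrite sumrMnl.
  by rewrite sumrMnl -/w; ring.
apply: (@qpd_cost_fin _ _ _ _ _ _ _ F).
(* An empty [I] would contradict [u_norm]. *)
- rewrite card_sum; case: (posnP #|I|) => [I0|I0]; last by rewrite addn_gt0 I0.
  move: u_norm; rewrite big_pred0 => [/esym/eqP|i]; first by rewrite oner_eq0.
  by have := card0_eq I0 i; rewrite inE.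
- have GLO i j s : in_class S (G i j s).
    apply: LO_in_class; exists (real_part (z s *: P i) (P j)), (real_part (z s *: Q i) (Q j)).
    have zs : `|z s| = 1 by case: (s); rewrite ?normCi ?normr1.
    by split=> //; apply: real_part_local => //; apply: unitarymxZ.
  by case=> [i|[[i j] s]]; exact: GLO.
rewrite schmidt_channelE sum_diag_split big_sumType /=; congr (_ + _).
  by apply: eq_bigr => i _; rewrite /G /= !scale1r !real_part_diag tensop_sandwich.
have -> := sum_triple (fun i j s => ((-1) ^+ s * w i j)%:C%C *: G i j s).
(* Each ordered pair yields half of [T i j] and half of [T j i]; since [w] is symmetric, the
   reversed pair supplies the missing halves. *)
have GE i j : ((-1) ^+ true * w i j)%:C%C *: G i j true +
    ((-1) ^+ false * w i j)%:C%C *: G i j false =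
    (2^-1 * w i j)%:C%C *: T i j + (2^-1 * w i j)%:C%C *: T j i.
  have := real_part_tens (P i) (P j) (Q i) (Q j).
  rewrite expr0 expr1 mulN1r mul1r rmorphN scaleNr [in X in _ -> X]addrC.
  rewrite -(scalerBr ((w i j)%:C%C)) [G i j false]/G [G i j true]/G.
  rewrite /z !scale1r => ->.
  rewrite -scalerDr rmorphM /= -mulrC -scalerA; congr (_ *: (_ *: _)).
  by rewrite fmorphV rmorph_nat.
under [RHS]eq_bigr do (under eq_bigr do rewrite GE; rewrite big_split /=).
rewrite big_split /= [X in _ = _ + X]exchange_big /= -big_split; apply: eq_bigr => i _ /=.
rewrite -big_split; apply: eq_bigr => j _ /=.
have -> : w j i = w i j by rewrite /w eq_sym mulrC.
rewrite -scalerDl -rmorphD /= -mulrDr half_double.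
by rewrite /w; case: (i != j); rewrite ?mulr1n // !mulr0n scale0r.
Qed.

Lemma tr_schmidt i : \tr ((P i *t Q i)^t* *m W) = (u i)%:C%C * (a * b)%:R.
Proof.
rewrite /W mulmx_sumr linear_sum (bigD1 i) //= big1 => [|j ne].
  by rewrite addr0 -scalemxAr mxtraceZ trmxC_tens tensmx_mul mxtrace_tens oP oQ eqxx -natrM.
rewrite -scalemxAr mxtraceZ trmxC_tens tensmx_mul mxtrace_tens oP.
by rewrite eq_sym (negbTE ne) mul0r mulr0.
Qed.

Lemma witness_schmidt :
  witness P Q (unitary_channel W) =
  (2 * (\sum_i u i) ^+ 2 - 1)%:C%C * (a * b)%:R ^+ 2.
Proof.
rewrite unitary_channel_sandwich /witness.
have -> : overlap P Q (sandwich W W) = (\sum_i u i)%:C%C ^+ 2 * (a * b)%:R ^+ 2.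
  rewrite /overlap -exprMn expr2 rmorph_sum !mulr_suml; apply: eq_bigr => i _.
  rewrite mulr_sumr; apply: eq_bigr => j _.
  rewrite choi_form_sandwich !tr_schmidt; congr (_ * _); apply: geC0_conj.
  by apply: mulr_ge0; [rewrite ler0c|exact: ler0n].
have -> : \tr (sandwich W W 1%:M) = (a * b)%:R.
  rewrite sandwichE mulmx1 mxtrace_mulC {1}/W trmxC_sum mulmx_suml linear_sum /=.
  rewrite (eq_bigr (fun i => (u i ^+ 2)%:C%C * (a * b)%:R)) => [|i _].
    by rewrite -mulr_suml -rmorph_sum u_norm mul1r.
  rewrite trmxCZ -scalemxAl mxtraceZ tr_schmidt mulrA; congr (_ * _).
  have -> : ((u i)%:C%C)^* = (u i)%:C%C :> C by exact: conjc_real.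
  by rewrite -rmorphM.
have morphE (f : {rmorphism R -> C}) x : f (2 * x ^+ 2 - 1) = 2 * f x ^+ 2 - 1.
  by rewrite rmorphB rmorphM rmorphXn rmorph_nat rmorph1.
have ringE (K : comPzRingType) (x y : K) :
  x ^+ 2 * y ^+ 2 *+ 2 - y * y = (2 * x ^+ 2 - 1) * y ^+ 2 by ring.
by rewrite (morphE (real_complex R)); exact: ringE.
Qed.

(** The witness is linear, at most [(a * b) ^+ 2] in modulus on each [F i], and known exactly on the
    channel of [W]. *)
Lemma gamma_lower S c : qpd_cost S (unitary_channel W) c ->
  2 * (\sum_i u i) ^+ 2 - 1 <= c.
Proof.
case=> m [x [F [_ FS WE ->]]]; rewrite -lecR.
have N0 : 0 < (a * b)%:R ^+ 2 :> C by rewrite exprn_gt0 // ltr0n muln_gt0 a_gt0.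
rewrite -(ler_pM2r N0) -witness_schmidt WE witness_sumZ.
(* Comparing a complex number with its modulus requires it to be real; this sum is, being the
   witness of the channel of [W]. *)
have mono : \sum_i (x i)%:C%C * witness P Q (F i) <=
    `|\sum_i (x i)%:C%C * witness P Q (F i)|.
  apply: real_ler_norm; rewrite -witness_sumZ -WE witness_schmidt.
  by rewrite realM ?realX ?realn //; apply/complex_realP; eexists.
apply: le_trans mono _; apply: le_trans (ler_norm_sum _ _ _) _.
rewrite rmorph_sum mulr_suml; apply: ler_sum => i _; rewrite normrM.
have -> : `|(x i)%:C%C| = (`|x i|)%:C%C :> C.
  by rewrite normc_def /= expr0n addr0 sqrtr_sqr.
apply: ler_wpM2l; first by rewrite ler0c.
by apply: witness_signed_separable => //; exact: in_class_signed_separable (FS i).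
Qed.

Theorem gamma_schmidt S :
  is_gamma S (unitary_channel W) (2 * (\sum_i u i) ^+ 2 - 1).
Proof. by split; [exact: gamma_upper|exact: gamma_lower]. Qed.

End SchmidtGamma.

(** * Simultaneous real singular value decomposition *)

Section RealSingularValues.
Variable C : numClosedFieldType.
Implicit Types n : nat.

Local Notation "A ^c" := (map_mx Num.conj_op A).

(** Real matrices are encoded as complex ones fixed by conjugation, so that eigenvectors can be
    taken over the closed field. *)
Definition real_orthogonal n (O : 'M[C]_n) : Prop := O^c = O /\ O *m O^T = 1%:M.

Lemma conjmxK m n (A : 'M[C]_(m, n)) : A^c^c = A.
Proof. by apply/matrixP => i j; rewrite !mxE conjCK. Qed.

Lemma mulmx_trmxC_eq0 m n (A : 'M[C]_(m, n)) : A *m A^t* = 0 -> A = 0.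
Proof.
move=> A0; apply/matrixP => i j; rewrite mxE.
have /matrixP/(_ i i) := A0; rewrite !mxE.
under eq_bigr do rewrite !mxE -normCK.
move/psumr_eq0P => /(_ (fun k _ => exprn_ge0 _ (normr_ge0 _)))/(_ j isT)/eqP.
by rewrite sqrf_eq0 normr_eq0 => /eqP.
Qed.

(** [y + y^c] is real; if it vanishes, then [y] is purely imaginary and ['i *: y] is real and
    nonzero. *)
Lemma real_eigenvector n (A : 'M[C]_n) (s : C) (y : 'rV[C]_n) :
  y != 0 -> y *m A = s *: y -> y^c *m A = s *: y^c ->
  exists r : 'rV[C]_n, [/\ r != 0, r^c = r & r *m A = s *: r].
Proof.
move=> y0 yA yA'; have [yc|yc] := eqVneq (y + y^c) 0.
  exists ('i *: y); split.
  - by rewrite scaler_eq0 negb_or neq0Ci.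
  - move/eqP: yc; rewrite addr_eq0 => /eqP {2}->.
    by rewrite map_mxZ /= conjCi scalerN scaleNr.
  - by rewrite -scalemxAl yA !scalerA mulrC.
exists (y + y^c); split=> //.
  by rewrite map_mxD conjmxK addrC.
by rewrite mulmxDl yA yA' scalerDr.
Qed.

Lemma real_unit_vector n (r : 'rV[C]_n) : r != 0 -> r^c = r ->
  exists2 k : C, k != 0 & (k *: r)^c = k *: r /\ (k *: r) *m (k *: r)^T = 1%:M.
Proof.
move=> r0 rr; pose q := (r *m r^T) 0 0.
have qE : q = \sum_i `|r 0 i| ^+ 2.
  rewrite /q mxE; apply: eq_bigr => i _; rewrite mxE normCK; congr (_ * _).
  by rewrite -{1}rr mxE.
have q0 : 0 < q.
  rewrite lt_neqAle qE sumr_ge0 ?andbT => [|i _]; last by rewrite exprn_ge0.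
  apply: contra r0 => /eqP /esym.
  move/psumr_eq0P => /(_ (fun k _ => exprn_ge0 _ (normr_ge0 _))) h.
  apply/eqP/rowP => i; rewrite mxE; have /eqP := h i isT.
  by rewrite sqrf_eq0 normr_eq0 => /eqP.
have sq0 : 0 < (sqrtC q)^-1 by rewrite invr_gt0 sqrtC_gt0.
exists (sqrtC q)^-1; first by rewrite gt_eqF.
split; first by rewrite map_mxZ rr /= geC0_conj // ltW.
rewrite linearZ -scalemxAl -scalemxAr scalerA -expr2 exprVn sqrtCK.
by rewrite [r *m _]mx11_scalar scale_scalar_mx -/q mulVf // gt_eqF.
Qed.

(* For s <> 0, v and w come from a common real eigenvector (w, v) of the normal
   matrix [0, M; M^T, 0]; for singular M, from the real kernels of M and M^T. *)
Lemma real_singular_pair n (M : 'M[C]_n.+1) :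
  (M *m M^t*)^c = M *m M^t* -> (M^t* *m M)^c = M^t* *m M ->
  exists (s : C) (v w : 'rV[C]_n.+1),
    [/\ v^c = v /\ v *m v^T = 1%:M, w^c = w /\ w *m w^T = 1%:M,
        v *m M^T = s *: w & w *m M = s *: v].
Proof.
move=> GR HR.
have [dM|dM] := eqVneq (\det M) 0.
  have ker (N : 'M[C]_n.+1) : \det N = 0 -> (N *m N^t*)^c = N *m N^t* ->
      exists r : 'rV[C]_n.+1, [/\ r^c = r, r *m r^T = 1%:M & r *m N = 0].
    move=> dN NR; have : \det (N *m N^t*) == 0 by rewrite det_mulmx dN mul0r.
    case/det0P => y y0 yN.
    have [||r [r0 rr rN]] := @real_eigenvector _ (N *m N^t*) 0 y y0.
    - by rewrite yN scale0r.
    - by rewrite -NR -map_mxM yN map_mx0 scale0r.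
    have [k k0 [kr k1]] := real_unit_vector r0 rr.
    exists (k *: r); split=> //; apply: mulmx_trmxC_eq0.
    by rewrite trmxC_mul mulmxA -(mulmxA _ N) -!scalemxAl rN scale0r !(mul0mx, scaler0).
  have [||v [v1 v2 v3]] := ker M^T.
  - by rewrite det_tr.
  - have -> : M^T *m (M^T)^t* = (M^t* *m M)^c.
      by rewrite map_mxM trmxK /= conjmxK.
    by rewrite !HR.
  have [||w [w1 w2 w3]] := ker M => //.
  by exists 0, v, w; rewrite !scale0r.
pose S : 'M[C]_(n.+1 + n.+1) := block_mx 0 M M^T 0.
have SE : S^t* = S^c by rewrite tr_block_mx trmxK !trmx0.
have McT : M^c *m M^T = M *m M^t*.
  by rewrite -GR map_mxM conjmxK.
have MTc : M^T *m M^c = M^t* *m M.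
  by rewrite -HR map_mxM conjmxK.
have SN : S *m S^t* = S^t* *m S.
  rewrite SE /S map_block_mx !mulmx_block !map_mx0 !(mul0mx, mulmx0, addr0, add0r).
  by rewrite McT MTc.
have [//|y y0 /andP[/sub_rVP[s ys] /sub_rVP[t yt]]] := common_eigenvector2 _ SN.
(* Since [S^t* = S^c], conjugating [y *m S^t* = s^* *: y] shows that [y^c] is also an eigenvector of
   [S] for [s], as [real_eigenvector] demands. *)
have ts : t = s^*.
  have : y *m S *m y^t* = (y *m S^t* *m y^t*)^t*.
    by rewrite !trmxC_mul !trmxCK mulmxA.
  rewrite ys yt -!scalemxAl trmxCZ trmxC_mul trmxCK => /matrixP/(_ 0 0).
  rewrite [LHS]mxE [RHS]mxE => /mulIf h; apply: (can_inj conjCK); rewrite conjCK -h //.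
  apply: contra y0 => /eqP y1; apply/eqP/mulmx_trmxC_eq0.
  by rewrite [LHS]mx11_scalar y1 raddf0.
have [|r [r0 rr rS]] := real_eigenvector y0 ys.
  by rewrite -[in LHS](conjmxK S) -map_mxM -SE yt map_mxZ ts /= conjCK.
pose w := lsubmx r; pose v := rsubmx r.
have rE : r = row_mx w v by rewrite hsubmxK.
have [vM wM] : v *m M^T = s *: w /\ w *m M = s *: v.
  move: rS; rewrite rE /S mul_row_block !mulmx0 addr0 add0r scale_row_mx.
  by move/eq_row_mx.
have [vr wr] : v^c = v /\ w^c = w.
  by move: rr; rewrite rE map_row_mx => /eq_row_mx[-> ->].
have uM : M \in unitmx by rewrite unitmxE unitfE.
have s0 : s != 0.
  apply: contra r0 => /eqP s0; rewrite rE.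
  rewrite -[w](mulmxK uM) wM s0 scale0r mul0mx.
  rewrite -[v](@mulmxK _ _ _ M^T) ?unitmx_tr // vM s0 scale0r mul0mx.
  by rewrite row_mx0.
(* Equal lengths allow one real factor [k] to normalize both vectors. *)
have vw : v *m v^T = w *m w^T.
  apply: (scalerI s0); transitivity (v *m (w *m M)^T).
    by rewrite wM [(_ *: _)^T]linearZ /= -scalemxAr.
  by rewrite trmx_mul mulmxA vM -scalemxAl.
have v0 : v != 0.
  apply: contra r0 => /eqP v0; have w0 : w = 0.
    by apply/eqP; move/eqP: vM; rewrite v0 mul0mx eq_sym scaler_eq0 (negbTE s0).
  by rewrite rE v0 w0 row_mx0.
have [k k0 [kr k1]] := real_unit_vector v0 vr.
have kR : k^* = k.
  move: kr; rewrite map_mxZ vr /= => /eqP; rewrite -subr_eq0 -scalerBl scaler_eq0.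
  by rewrite (negbTE v0) orbF subr_eq0 => /eqP.
have sqZ (x : 'rV[C]_n.+1) : (k *: x) *m (k *: x)^T = (k * k) *: (x *m x^T).
  by rewrite [(_ *: _)^T]linearZ /= -scalemxAl -scalemxAr scalerA.
exists s, (k *: v), (k *: w); split=> //; first split=> //.
- by rewrite map_mxZ wr /= kR.
- by rewrite -k1 !sqZ vw.
- by rewrite -scalemxAl vM !scalerA mulrC.
- by rewrite -scalemxAl wM !scalerA mulrC.
Qed.

(** The reflection in the hyperplane orthogonal to [u = v - e] exchanges [e] and [v]. Its
    coefficient is [2 / (u *m u^T) = c], since [u *m u^T = 2 * (1 - k)]. *)
Lemma householder n (v : 'rV[C]_n.+1) : v^c = v -> v *m v^T = 1%:M ->
  exists2 H : 'M[C]_n.+1, real_orthogonal H & H^T = H /\ delta_mx 0 0 *m H = v.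
Proof.
move=> vR v1; pose e : 'rV[C]_n.+1 := delta_mx 0 0; pose u := v - e.
pose k := v 0 0; pose c := (1 - k)^-1.
have eR : e^c = e by rewrite map_delta_mx.
have uR : u^c = u by rewrite map_mxB vR eR.
have ve : v *m e^T = k%:M.
  by rewrite trmx_delta -colE; apply/matrixP => i j; rewrite !ord1 !mxE eqxx mulr1n.
have ev : e *m v^T = k%:M by rewrite -[e]trmxK -trmx_mul ve tr_scalar_mx.
have ee : e *m e^T = 1%:M.
  by rewrite trmx_delta mul_delta_mx; apply/matrixP => i j; rewrite !ord1 !mxE.
have uu : u *m u^T = (2 * (1 - k))%:M.
  rewrite linearB mulmxBr !mulmxBl v1 ve ev ee -!raddfB /=.
  by congr (_%:M); ring.
have eu : e *m u^T = (k - 1)%:M by rewrite linearB mulmxBr ev ee -raddfB.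
have kR : k^* = k by rewrite /k -[in RHS]vR mxE.
(* Here [u] is real of length zero, so [v = e] and the identity serves. *)
have [k1|k1] := eqVneq (1 - k) 0.
  have u0 : u = 0.
    apply: mulmx_trmxC_eq0; rewrite -map_trmx uR uu k1 mulr0 raddf0 //.
  exists 1%:M; first by rewrite /real_orthogonal map_mx1 trmx1 mulmx1.
  by rewrite trmx1 mulmx1; split=> //; apply/eqP; rewrite eq_sym -subr_eq0 -/e -/u u0.
have HT : (1%:M - c *: (u^T *m u))^T = 1%:M - c *: (u^T *m u).
  by rewrite linearB linearZ /= trmx1 trmx_mul trmxK.
have EE : (c *: (u^T *m u)) *m (c *: (u^T *m u)) = c *: (u^T *m u) + c *: (u^T *m u).
  rewrite -scalemxAl -scalemxAr -(mulmxA u^T) (mulmxA u) uu mul_scalar_mx.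
  rewrite -scalemxAr !scalerA -scalerDl; congr (_ *: _).
  by rewrite /c; field.
exists (1%:M - c *: (u^T *m u)); [split|split=> //].
- rewrite map_mxB map_mx1 map_mxZ map_mxM -map_trmx uR /=.
  by rewrite /c fmorphV rmorphB /= kR conjC1.
- by rewrite HT mulmxBr mulmx1 mulmxBl mul1mx EE opprB addrK subrK.
- rewrite mulmxBr mulmx1 -scalemxAr mulmxA eu mul_scalar_mx scalerA.
  have -> : c * (k - 1) = -1 by rewrite /c; field.
  by rewrite scaleN1r opprK addrC subrK.
Qed.

(** Induction on the size: reflections carrying a real singular pair to the first basis vector split
    off a 1 by 1 block, and the rest [N] inherits both reality conditions. The diagonal may be
    complex. *)
Lemma real_svd n (M : 'M[C]_n) :
  (M *m M^t*)^c = M *m M^t* -> (M^t* *m M)^c = M^t* *m M ->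
  exists O1 O2 : 'M[C]_n, [/\ real_orthogonal O1, real_orthogonal O2 &
    exists d, O1 *m M *m O2 = diag_mx d].
Proof.
elim: n M => [|n IH] M GR HR.
  have o0 : real_orthogonal (0 : 'M[C]_0) by split; apply/matrixP => -[].
  by exists 0, 0; split=> //; exists 0; apply/matrixP => -[].
have [s [v [w [[vR v1] [wR w1] vM wM]]]] := real_singular_pair GR HR.
have [H1 [H1R H1O] [H1T eH1]] := householder wR w1.
have [H2 [H2R H2O] [H2T eH2]] := householder vR v1.
have H11 : H1 *m H1 = 1%:M by rewrite -{2}H1T.
have H22 : H2 *m H2 = 1%:M by rewrite -{2}H2T.
have H1t : H1^t* = H1 by rewrite H1T H1R.
have H2t : H2^t* = H2 by rewrite H2T H2R.
set e : 'rV[C]_n.+1 := delta_mx 0 0 in eH1 eH2.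
have vH2 : v *m H2 = e by rewrite -eH2 -mulmxA H22 mulmx1.
have wH1 : w *m H1 = e by rewrite -eH1 -mulmxA H11 mulmx1.
have [M' M'D] : {M' : 'M[C]_(1 + n) | M' = H1 *m M *m H2} by eexists.
have eM : e *m M' = s *: e by rewrite M'D !mulmxA eH1 wM -scalemxAl vH2.
have eMT : e *m M'^T = s *: e.
  by rewrite M'D !trmx_mul H1T H2T !mulmxA eH2 vM -scalemxAl wH1.
pose N : 'M[C]_n := drsubmx M'.
have M'E : M' = block_mx (s%:M : 'M_1) 0 0 N :> 'M_(1 + n).
  have M0 j : M' 0 j = s * (j == 0)%:R.
    have /rowP/(_ j) := eM; rewrite -rowE !mxE eq_sym => ->; by rewrite eqxx.
  have Mj0 j : M' j 0 = s * (j == 0)%:R.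
    have /rowP/(_ j) := eMT; rewrite -rowE !mxE eq_sym => ->; by rewrite eqxx.
  have l0 : lshift n (0 : 'I_1) = 0 by exact: val_inj.
  rewrite -[LHS](@submxK _ 1 n 1 n); congr block_mx.
  - apply/matrixP => i j; rewrite !ord1 mxE [usubmx _ _ _]mxE !l0 M0 mxE.
    by rewrite eqxx mulr1.
  - by apply/matrixP => i j; rewrite !ord1 mxE [usubmx _ _ _]mxE l0 M0 mxE mulr0.
  - by apply/matrixP => i j; rewrite !ord1 mxE [dsubmx _ _ _]mxE l0 Mj0 mxE mulr0.
have G' : M' *m M'^t* = H1 *m (M *m M^t*) *m H1.
  rewrite M'D !trmxC_mul H1t H2t !mulmxA -(mulmxA _ H2 H2) H22 mulmx1 //.
have H' : M'^t* *m M' = H2 *m (M^t* *m M) *m H2.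
  rewrite M'D !trmxC_mul H1t H2t !mulmxA -(mulmxA _ H1 H1) H11 mulmx1 //.
have M't : M'^t* = block_mx ((s%:M : 'M_1)^t*) 0 0 (N^t*) :> 'M_(1 + n).
  by rewrite M'E tr_block_mx map_block_mx !trmx0 !map_mx0.
have NG : (N *m N^t*)^c = N *m N^t*.
  have : (M' *m M'^t*)^c = M' *m M'^t* by rewrite G' !map_mxM /= -map_mxM GR H1R.
  rewrite M't M'E mulmx_block map_block_mx => /eq_block_mx[_ _ _].
  by rewrite !mul0mx !add0r.
have NH : (N^t* *m N)^c = N^t* *m N.
  have : (M'^t* *m M')^c = M'^t* *m M' by rewrite H' !map_mxM /= -map_mxM HR H2R.
  rewrite M't M'E mulmx_block map_block_mx => /eq_block_mx[_ _ _].
  by rewrite !mul0mx !add0r.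
have [O1 [O2 [[O1R O1O] [O2R O2O] [d dE]]]] := IH N NG NH.
have ext (O : 'M[C]_n) (H : 'M[C]_n.+1) : O^c = O -> O *m O^T = 1%:M ->
    H^c = H -> H *m H^T = 1%:M ->
    real_orthogonal ((block_mx (1%:M : 'M_1) 0 0 O : 'M_(1 + n)) *m H).
  move=> OR OO HR' HO; split.
    by rewrite map_mxM HR' map_block_mx map_mx1 !map_mx0 OR.
  rewrite trmx_mul mulmxA -(mulmxA _ H) HO mulmx1 tr_block_mx !trmx0 trmx1 mulmx_block.
  by rewrite OO !mulmx0 !mul0mx mulmx1 !addr0 add0r -scalar_mx_block.
have orthT m (O : 'M[C]_m) : real_orthogonal O -> real_orthogonal O^T.
  by move=> [OR OO]; split; [rewrite -map_trmx OR|rewrite trmxK; exact: mulmx1C].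
exists ((block_mx (1%:M : 'M_1) 0 0 O1 : 'M_(1 + n)) *m H1).
exists ((block_mx (1%:M : 'M_1) 0 0 O2^T : 'M_(1 + n)) *m H2)^T.
have [O2R' O2O'] := orthT _ _ (conj O2R O2O).
split; [exact: ext|apply: orthT; exact: ext|exists (row_mx s%:M d)].
set B1 : 'M[C]_(1 + n) := block_mx _ _ _ O1; set B2 : 'M[C]_(1 + n) := block_mx _ _ _ O2^T.
have -> : B1 *m H1 *m M *m (B2 *m H2)^T = B1 *m M' *m B2^T.
  by rewrite trmx_mul H2T M'D !mulmxA.
rewrite M'E /B1 /B2 tr_block_mx trmxK !trmx0 trmx1 !mulmx_block.
rewrite !(mulmx0, mul0mx, mulmx1, mul1mx, addr0, add0r) dE.
transitivity (diag_mx (row_mx (s%:M : 'rV_1) d)); last by [].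
rewrite diag_mx_row.
by have -> : diag_mx (s%:M : 'rV_1) = s%:M by apply/matrixP => i j; rewrite !ord1 !mxE eqxx.
Qed.

End RealSingularValues.

(** * Two-qubit unitaries *)

Section Quaternions.
Variable C : numClosedFieldType.

(** The identity and ['i] times the Pauli matrices Z, Y, X. With these factors ['i], real
    combinations are multiples of unitaries. *)
Definition quaternion (k : 'I_4) : 'M[C]_2 := \matrix_(r, c)
  match nat_of_ord k, nat_of_ord r, nat_of_ord c with
  | 0%N, 0%N, 0%N | 0%N, 1%N, 1%N => 1
  | 1%N, 0%N, 0%N => 'i | 1%N, 1%N, 1%N => - 'i
  | 2%N, 0%N, 1%N => 1 | 2%N, 1%N, 0%N => -1
  | 3%N, 0%N, 1%N | 3%N, 1%N, 0%N => 'i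
  | _, _, _ => 0
  end.

Lemma sum_ord4 (V : nmodType) (F : 'I_4 -> V) :
  \sum_i F i = F (@Ordinal 4 0 isT) + F (@Ordinal 4 1 isT) +
    F (@Ordinal 4 2 isT) + F (@Ordinal 4 3 isT).
Proof.
rewrite !big_ord_recl big_ord0 addr0 !addrA.
by congr (F _ + F _ + F _ + F _); apply: val_inj.
Qed.

Lemma sum_ord2 (V : nmodType) (F : 'I_2 -> V) : \sum_i F i = F 0 + F 1.
Proof.
by rewrite !big_ord_recl big_ord0 addr0; congr (F _ + F _); apply: val_inj.
Qed.

Lemma ord4P (P : 'I_4 -> Prop) : P (@Ordinal 4 0 isT) -> P (@Ordinal 4 1 isT) ->
  P (@Ordinal 4 2 isT) -> P (@Ordinal 4 3 isT) -> forall i, P i.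
Proof.
move=> P0 P1 P2 P3 [[|[|[|[|//]]]] ?].
- by rewrite (_ : Ordinal _ = @Ordinal 4 0 isT) //; exact: val_inj.
- by rewrite (_ : Ordinal _ = @Ordinal 4 1 isT) //; exact: val_inj.
- by rewrite (_ : Ordinal _ = @Ordinal 4 2 isT) //; exact: val_inj.
- by rewrite (_ : Ordinal _ = @Ordinal 4 3 isT) //; exact: val_inj.
Qed.

Lemma ord2P (P : 'I_2 -> Prop) : P 0 -> P 1 -> forall i, P i.
Proof.
move=> P0 P1 [[|[|//]] ?].
- by rewrite (_ : Ordinal _ = 0) //; exact: val_inj.
- by rewrite (_ : Ordinal _ = 1) //; exact: val_inj.
Qed.

Let ii : 'i * 'i = -1 :> C. Proof. by rewrite -expr2 sqrCi. Qed.

Let conjN (z : C) : (- z)^* = - z^*. Proof. exact: rmorphN. Qed.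

Local Ltac qsimp := rewrite ?(ii, conjN, conjC0, conjC1, conjCi, mulr0, mul0r, mulr1,
  mul1r, mulrN, mulNr, opprK, addr0, add0r, oppr0, subrr, addNr) //=.

Local Ltac qsimp_in H := rewrite ?(ii, conjN, conjC0, conjC1, conjCi, mulr0, mul0r, mulr1,
  mul1r, mulrN, mulNr, opprK, addr0, add0r, oppr0, subrr, addNr) /= in H.

(** The polarized form of the quaternion norm: it cancels the cross terms of P^t* P for real
    combinations P. *)
Lemma quaternion_anticomm i j :
  (quaternion i)^t* *m quaternion j + (quaternion j)^t* *m quaternion i =
  (2 *+ (i == j))%:M.
Proof.
apply/matrixP; elim/ord4P: i; elim/ord4P: j; elim/ord2P; elim/ord2P;
  rewrite !mxE !sum_ord2 !mxE /=; qsimp; rewrite ?mulr0n ?mulr1n; qsimp.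
Qed.

Lemma quaternion_trace i j :
  \tr ((quaternion i)^t* *m quaternion j) = 2 *+ (i == j).
Proof.
elim/ord4P: i; elim/ord4P: j;
  rewrite /mxtrace sum_ord2 !mxE !sum_ord2 !mxE /=; qsimp; rewrite ?mulr0n ?mulr1n; qsimp.
Qed.

Lemma quaternion_trace_r i j :
  \tr (quaternion i *m (quaternion j)^t*) = 2 *+ (i == j).
Proof. by rewrite mxtrace_mulC quaternion_trace eq_sym. Qed.

Lemma quaternion_span (A : 'M[C]_2) :
  A = \sum_k (2^-1 * \tr ((quaternion k)^t* *m A)) *: quaternion k.
Proof.
apply/matrixP; elim/ord2P; elim/ord2P; rewrite summxE sum_ord4 !mxE /mxtrace !sum_ord2 /=
  !mxE !sum_ord2 !mxE /=; qsimp.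
- have -> : 2^-1 * (- ('i * A 0 0) + 'i * A 1 1) * 'i =
      2^-1 * ('i * 'i) * (A 1 1 - A 0 0) by ring.
  by rewrite ii; field.
- have -> : 2^-1 * (- ('i * A 1 0) - 'i * A 0 1) * 'i =
      - (2^-1 * ('i * 'i) * (A 0 1 + A 1 0)) by ring.
  by rewrite ii; field.
- have -> : 2^-1 * (- ('i * A 1 0) - 'i * A 0 1) * 'i =
      - (2^-1 * ('i * 'i) * (A 0 1 + A 1 0)) by ring.
  by rewrite ii; field.
- have -> : 2^-1 * (- ('i * A 0 0) + 'i * A 1 1) * 'i =
      2^-1 * ('i * 'i) * (A 1 1 - A 0 0) by ring.
  by rewrite ii; field.
Qed.

Lemma quaternion_mulE_r i k r c :
  (quaternion i *m (quaternion k)^t*) r c =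
  quaternion i r 0 * (quaternion k c 0)^* + quaternion i r 1 * (quaternion k c 1)^*.
Proof. by rewrite mxE sum_ord2 !mxE. Qed.

Lemma quaternion_mulE_l i k r c :
  ((quaternion k)^t* *m quaternion i) r c =
  (quaternion k 0 r)^* * quaternion i 0 c + (quaternion k 1 r)^* * quaternion i 1 c.
Proof. by rewrite mxE sum_ord2 !mxE. Qed.

(** Let l, m, n be the three imaginary units. The coefficient of l in each sum is G l 0 - G 0 l plus
    or minus (G m n - G n m). Reversing the order of the factors flips only the sign of the second
    bracket, so both brackets vanish. *)
Lemma quaternion_symmetric (G : 'M[C]_4) :
  \sum_i \sum_k G i k *: (quaternion i *m (quaternion k)^t*) = 1%:M ->
  \sum_i \sum_k G i k *: ((quaternion k)^t* *m quaternion i) = 1%:M ->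
  G^T = G.
Proof.
move=> /matrixP E1 /matrixP E2.
have F1 r c : \sum_i \sum_k G i k * (quaternion i r 0 * (quaternion k c 0)^* +
    quaternion i r 1 * (quaternion k c 1)^*) = (r == c)%:R.
  have := E1 r c; rewrite summxE [RHS]mxE => <-; apply: eq_bigr => i _.
  by rewrite summxE; apply: eq_bigr => k _; rewrite [RHS]mxE quaternion_mulE_r.
have F2 r c : \sum_i \sum_k G i k * ((quaternion k 0 r)^* * quaternion i 0 c +
    (quaternion k 1 r)^* * quaternion i 1 c) = (r == c)%:R.
  have := E2 r c; rewrite summxE [RHS]mxE => <-; apply: eq_bigr => i _.
  by rewrite summxE; apply: eq_bigr => k _; rewrite [RHS]mxE quaternion_mulE_l.
have a1 := F1 0 0; rewrite !sum_ord4 !mxE /= in a1; qsimp_in a1.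
have a2 := F1 0 1; rewrite !sum_ord4 !mxE /= in a2; qsimp_in a2.
have a3 := F1 1 0; rewrite !sum_ord4 !mxE /= in a3; qsimp_in a3.
have a4 := F1 1 1; rewrite !sum_ord4 !mxE /= in a4; qsimp_in a4.
have b1 := F2 0 0; rewrite !sum_ord4 !mxE /= in b1; qsimp_in b1.
have b2 := F2 0 1; rewrite !sum_ord4 !mxE /= in b2; qsimp_in b2.
have b3 := F2 1 0; rewrite !sum_ord4 !mxE /= in b3; qsimp_in b3.
have b4 := F2 1 1; rewrite !sum_ord4 !mxE /= in b4; qsimp_in b4.
have n4 : 4 != 0 :> C by rewrite pnatr_eq0.
have n4i : 4 * 'i != 0 :> C by rewrite mulf_neq0 ?neq0Ci.
have cancel k (x y : C) : k != 0 -> k * (x - y) = 0 -> x = y.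
  by move=> k0 /eqP; rewrite mulf_eq0 (negbTE k0) subr_eq0 => /eqP.
(* The difference of the diagonal entries isolates unit 1, the difference of the off-diagonal
   entries unit 2, and their sum unit 3; [A] and [B] denote the two orders of multiplication. *)
have dA := congr2 (fun x y => x - y) a1 a4.
have dB := congr2 (fun x y => x - y) b1 b4.
have mA := congr2 (fun x y => x - y) a2 a3.
have mB := congr2 (fun x y => x - y) b2 b3.
have pA := congr2 (fun x y => x + y) a2 a3.
have pB := congr2 (fun x y => x + y) b2 b3.
have h10 : G (@Ordinal 4 1 isT) (@Ordinal 4 0 isT) = G (@Ordinal 4 0 isT) (@Ordinal 4 1 isT).
  apply: (cancel _ _ _ n4i).
  by apply: etrans (etrans _ (congr2 (fun x y => x + y) dA dB)) _ => /=; ring.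
have h32 : G (@Ordinal 4 3 isT) (@Ordinal 4 2 isT) = G (@Ordinal 4 2 isT) (@Ordinal 4 3 isT).
  apply: (cancel _ _ _ n4i).
  by apply: etrans (etrans _ (congr2 (fun x y => x - y) dA dB)) _ => /=; ring.
have h20 : G (@Ordinal 4 2 isT) (@Ordinal 4 0 isT) = G (@Ordinal 4 0 isT) (@Ordinal 4 2 isT).
  apply: (cancel _ _ _ n4).
  by apply: etrans (etrans _ (congr2 (fun x y => x + y) mA mB)) _ => /=; ring.
have h13 : G (@Ordinal 4 1 isT) (@Ordinal 4 3 isT) = G (@Ordinal 4 3 isT) (@Ordinal 4 1 isT).
  apply: (cancel _ _ _ n4).
  by apply: etrans (etrans _ (congr2 (fun x y => x - y) mA mB)) _ => /=; ring.
have h30 : G (@Ordinal 4 3 isT) (@Ordinal 4 0 isT) = G (@Ordinal 4 0 isT) (@Ordinal 4 3 isT).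
  apply: (cancel _ _ _ n4i).
  by apply: etrans (etrans _ (congr2 (fun x y => x + y) pA pB)) _ => /=; ring.
have h21 : G (@Ordinal 4 2 isT) (@Ordinal 4 1 isT) = G (@Ordinal 4 1 isT) (@Ordinal 4 2 isT).
  apply: (cancel _ _ _ n4i).
  by apply: etrans (etrans _ (congr2 (fun x y => x - y) pA pB)) _ => /=; ring.
by apply/matrixP; elim/ord4P; elim/ord4P; rewrite mxE.
Qed.

End Quaternions.

(** * Schmidt decomposition of a two-qubit unitary into orthogonal unitaries *)

Section TwoQubitSchmidt.
Variable R : realType.
Local Notation C := R[i].
Local Notation q := (quaternion C).

Lemma quaternion_tens_span (U : 'M[C]_(2 * 2)) :
  exists M : 'M[C]_4, U = \sum_i \sum_j M i j *: (q i *t q j).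
Proof.
pose span (V : 'M[C]_(2 * 2)) := exists M : 'M[C]_4, V = \sum_i \sum_j M i j *: (q i *t q j).
have span0 : span 0.
  exists 0; rewrite big1 // => i _; rewrite big1 // => j _; by rewrite mxE scale0r.
have spanD V V' : span V -> span V' -> span (V + V').
  case=> [M ->] [M' ->]; exists (M + M'); rewrite -big_split; apply: eq_bigr => i _ /=.
  by rewrite -big_split; apply: eq_bigr => j _; rewrite mxE scalerDl.
have spanZ z V : span V -> span (z *: V).
  case=> [M ->]; exists (z *: M); rewrite scaler_sumr; apply: eq_bigr => i _.
  by rewrite scaler_sumr; apply: eq_bigr => j _; rewrite mxE scalerA.
have spanT A B : span (A *t B).
  exists (\matrix_(i, j) ((2^-1 * \tr ((q i)^t* *m A)) * (2^-1 * \tr ((q j)^t* *m B)))).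
  rewrite {1}(quaternion_span A) {1}(quaternion_span B) tensmx_suml.
  apply: eq_bigr => i _; rewrite tensmx_sumr; apply: eq_bigr => j _.
  by rewrite tensmx_scale mxE.
rewrite -/(span U) (matrix_sum_delta U).
elim/big_ind: _ => [//|V V'|x _]; first exact: spanD.
elim/big_ind: _ => [//|V V'|y _]; first exact: spanD.
apply: spanZ; case: (mxtens_indexP x) => x0 x1; case: (mxtens_indexP y) => y0 y1.
by rewrite delta_mx_tens.
Qed.

Lemma mxtrace_ext n (A B : 'M[C]_n) : (forall X, \tr (X *m A) = \tr (X *m B)) -> A = B.
Proof.
have trd (D : 'M[C]_n) i j : \tr (delta_mx j i *m D) = D i j.
  rewrite /mxtrace (bigD1 j) //= big1 ?addr0 => [|k nk].
    rewrite mxE (bigD1 i) //= big1 ?addr0 => [|l nl]; first by rewrite mxE !eqxx mul1r.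
    by rewrite mxE (negbTE nl) andbF mul0r.
  by rewrite mxE big1 // => l _; rewrite mxE (negbTE nk) mul0r.
by move=> AB; apply/matrixP => i j; rewrite -!trd AB.
Qed.

Section PartialTrace.
Variables (I J : finType) (a b : nat) (M : I -> J -> C).
Variables (f : I -> I -> 'M[C]_a) (g : J -> J -> 'M[C]_b).
Hypothesis fg1 : \sum_i \sum_j \sum_k \sum_l (M i j * (M k l)^*) *: (f i k *t g j l) = 1%:M.

Lemma partial_traceB (b_gt0 : (0 < b)%N) :
  (forall j l, \tr (g j l) = b%:R *+ (j == l)) ->
  \sum_i \sum_k (\sum_j M i j * (M k j)^*) *: f i k = 1%:M.
Proof.
move=> trg; apply: mxtrace_ext => X.
have b0 : b%:R != 0 :> C by rewrite pnatr_eq0 -lt0n.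
apply: (mulIf b0); rewrite mulmx1 -[in RHS](mxtrace1 C) -mxtrace_tens.
rewrite -[X *t 1%:M]mulmx1 -fg1 !mulmx_sumr !linear_sum mulr_suml; apply: eq_bigr => i _ /=.
rewrite !mulmx_sumr !linear_sum mulr_suml /=.
have E j : \tr ((X *t 1%:M) *m \sum_k \sum_l (M i j * (M k l)^*) *: (f i k *t g j l)) =
    \sum_k (M i j * (M k j)^*) * (\tr (X *m f i k) * b%:R).
  rewrite mulmx_sumr linear_sum; apply: eq_bigr => k _ /=.
  rewrite mulmx_sumr linear_sum (bigD1 j) //= big1 ?addr0 => [|l nl].
    by rewrite -scalemxAr mxtraceZ tensmx_mul mul1mx mxtrace_tens trg eqxx.
  rewrite -scalemxAr mxtraceZ tensmx_mul mul1mx mxtrace_tens trg eq_sym (negbTE nl).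
  by rewrite mulr0n !mulr0.
rewrite (eq_bigr _ (fun j _ => E j)) exchange_big; apply: eq_bigr => k _ /=.
by rewrite -scalemxAr mxtraceZ -mulrA mulr_suml.
Qed.

Lemma partial_traceA (a_gt0 : (0 < a)%N) :
  (forall i k, \tr (f i k) = a%:R *+ (i == k)) ->
  \sum_j \sum_l (\sum_i M i j * (M i l)^*) *: g j l = 1%:M.
Proof.
move=> trf; apply: mxtrace_ext => X.
have a0 : a%:R != 0 :> C by rewrite pnatr_eq0 -lt0n.
apply: (mulfI a0); rewrite mulmx1 -[in RHS](mxtrace1 C) -mxtrace_tens.
rewrite -[1%:M *t X]mulmx1 -fg1 [in RHS]mulmx_sumr [RHS]linear_sum /=.
have E i : \tr ((1%:M *t X) *m \sum_j \sum_k \sum_l (M i j * (M k l)^*) *: (f i k *t g j l)) =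
    \sum_j \sum_l (M i j * (M i l)^*) * (a%:R * \tr (X *m g j l)).
  rewrite mulmx_sumr linear_sum; apply: eq_bigr => j _ /=.
  rewrite mulmx_sumr linear_sum (bigD1 i) //= [X in _ + X]big1 ?addr0 => [|k nk].
    rewrite mulmx_sumr linear_sum; apply: eq_bigr => l _ /=.
    by rewrite -scalemxAr mxtraceZ tensmx_mul mul1mx mxtrace_tens trf eqxx.
  rewrite mulmx_sumr linear_sum big1 // => l _ /=.
  rewrite -scalemxAr mxtraceZ tensmx_mul mul1mx mxtrace_tens trf eq_sym (negbTE nk).
  by rewrite mulr0n mul0r mulr0.
rewrite (eq_bigr _ (fun i _ => E i)) [RHS]exchange_big.
rewrite mulmx_sumr linear_sum mulr_sumr; apply: eq_bigr => j _ /=.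
rewrite mulmx_sumr linear_sum mulr_sumr [RHS]exchange_big; apply: eq_bigr => l _ /=.
by rewrite -scalemxAr mxtraceZ mulrCA mulr_suml.
Qed.

End PartialTrace.

(** Tracing out one side of U U^t* and of U^t* U gives the two identities of [quaternion_symmetric].
    A matrix both Hermitian and symmetric is real. *)
Lemma unitary_coef_real (M : 'M[C]_4) :
  let U := \sum_i \sum_j M i j *: (q i *t q j) in U \is unitarymx ->
  map_mx Num.conj_op (M *m M^t*) = M *m M^t* /\
  map_mx Num.conj_op (M^t* *m M) = M^t* *m M.
Proof.
move=> U /unitarymxP UU; have U'U := mulmx1C UU.
have Uc : U^t* = \sum_k \sum_l (M k l)^* *: ((q k)^t* *t (q l)^t*).
  rewrite trmxC_sum; apply: eq_bigr => k _; rewrite trmxC_sum; apply: eq_bigr => l _.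
  by rewrite trmxCZ trmxC_tens.
have E1 : \sum_i \sum_j \sum_k \sum_l (M i j * (M k l)^*) *:
    ((q i *m (q k)^t*) *t (q j *m (q l)^t*)) = 1%:M.
  rewrite -UU Uc mulmx_suml; apply: eq_bigr => i _; rewrite mulmx_suml; apply: eq_bigr => j _.
  rewrite mulmx_sumr; apply: eq_bigr => k _; rewrite mulmx_sumr; apply: eq_bigr => l _.
  by rewrite -scalemxAl -scalemxAr scalerA tensmx_mul.
have E2 : \sum_i \sum_j \sum_k \sum_l (M i j * (M k l)^*) *:
    (((q k)^t* *m q i) *t ((q l)^t* *m q j)) = 1%:M.
  rewrite -U'U Uc mulmx_sumr; apply: eq_bigr => i _; rewrite mulmx_sumr; apply: eq_bigr => j _.
  rewrite mulmx_suml; apply: eq_bigr => k _; rewrite mulmx_suml; apply: eq_bigr => l _.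
  by rewrite -scalemxAl -scalemxAr scalerA tensmx_mul mulrC.
have tr2 j l : \tr ((q l)^t* *m q j) = 2 *+ (j == l) by rewrite quaternion_trace eq_sym.
have G1 : (M *m M^t*)^T = M *m M^t*.
  have GE i k : \sum_j M i j * (M k j)^* = (M *m M^t*) i k.
    by rewrite mxE; apply: eq_bigr => j _; rewrite !mxE.
  apply: quaternion_symmetric.
    rewrite -(partial_traceB E1 _ (quaternion_trace_r _)) //.
    by apply: eq_bigr => i _; apply: eq_bigr => k _; rewrite GE.
  rewrite -(partial_traceB E2 _ tr2) //.
  by apply: eq_bigr => i _; apply: eq_bigr => k _; rewrite GE.
(* Tracing out A produces the entrywise conjugate of [M^t* *m M]. *)
have G2 : (M^T *m map_mx Num.conj_op M)^T = M^T *m map_mx Num.conj_op M.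
  have GE j l : \sum_i M i j * (M i l)^* = (M^T *m map_mx Num.conj_op M) j l.
    by rewrite mxE; apply: eq_bigr => i _; rewrite !mxE.
  apply: quaternion_symmetric.
    rewrite -(partial_traceA E1 _ (quaternion_trace_r _)) //.
    by apply: eq_bigr => i _; apply: eq_bigr => k _; rewrite GE.
  rewrite -(partial_traceA E2 _ tr2) //.
  by apply: eq_bigr => i _; apply: eq_bigr => k _; rewrite GE.
split.
  rewrite -[RHS]G1 trmx_mul map_mxM conjmxK.
  by congr (_ *m _); rewrite -map_trmx trmxK.
rewrite map_mxM conjmxK -G2 trmx_mul trmxK.
by congr (_ *m _); rewrite map_trmx.
Qed.

Lemma quaternion_rotation (O : 'M[C]_4) : real_orthogonal O ->
  let P m := \sum_i O m i *: q i in
  (forall m, P m \is unitarymx) /\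
  (forall m n, \tr ((P m)^t* *m P n) = 2 *+ (m == n)).
Proof.
move=> [OR OO] P; have Oc m i : (O m i)^* = O m i by rewrite -[in RHS]OR mxE.
have PP m n : (P m)^t* *m P n = \sum_i \sum_j (O m i * O n j) *: ((q i)^t* *m q j).
  rewrite trmxC_sum mulmx_suml; apply: eq_bigr => i _; rewrite mulmx_sumr.
  by apply: eq_bigr => j _; rewrite trmxCZ -scalemxAl -scalemxAr scalerA Oc.
have OOE m n : \sum_i O m i * O n i = (m == n)%:R.
  by have /matrixP/(_ m n) := OO; rewrite !mxE => <-; apply: eq_bigr => i _; rewrite mxE.
split=> [m|m n]; last first.
  rewrite PP linear_sum (eq_bigr (fun i => 2 * (O m i * O n i))) => [|i _ /=].
    by rewrite -mulr_sumr OOE mulr_natr.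
  rewrite linear_sum (bigD1 i) //= big1 ?addr0 => [|j nj].
    by rewrite mxtraceZ quaternion_trace eqxx mulrC.
  by rewrite mxtraceZ quaternion_trace eq_sym (negbTE nj) mulr0n mulr0.
apply/unitarymxP/mulmx1C.
(* The double sum is averaged with its copy with [i] and [j] exchanged, so that
   [quaternion_anticomm] leaves only the diagonal. *)
rewrite -[LHS]scale_half_double {2}PP exchange_big {1}PP -big_split /=.
rewrite (eq_bigr (fun i => (2 * (O m i * O m i))%:M)) => [|i _].
  rewrite -raddf_sum -mulr_sumr OOE eqxx mulr1 scale_scalar_mx.
  by rewrite mulVf ?pnatr_eq0.
rewrite -big_split (bigD1 i) //= [X in _ + X]big1 ?addr0 => [|j nj].
  by rewrite -scalerDr quaternion_anticomm eqxx scale_scalar_mx mulrC.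
rewrite [O m j * _]mulrC -scalerDr quaternion_anticomm eq_sym (negbTE nj).
by rewrite scale_scalar_mx mulr0n mulr0 raddf0.
Qed.

(** [real_svd] diagonalizes the quaternion coefficients of [U]; the orthogonal factors rotate the
    two quaternion bases. *)
Theorem two_qubit_schmidt (U : 'M[C]_(2 * 2)) : U \is unitarymx ->
  exists (u : 'I_4 -> R) (P Q : 'I_4 -> 'M[C]_2),
    [/\ (forall i, P i \is unitarymx) /\ (forall i, Q i \is unitarymx),
        forall i j, \tr ((P i)^t* *m P j) = 2 *+ (i == j),
        forall i j, \tr ((Q i)^t* *m Q j) = 2 *+ (i == j),
        (forall i, 0 <= u i) /\ \sum_i u i ^+ 2 = 1 &
        U = \sum_i (u i)%:C%C *: (P i *t Q i)].
Proof.
move=> uU; have [M UE] := quaternion_tens_span U.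
have [GR HR] : map_mx Num.conj_op (M *m M^t*) = M *m M^t* /\
    map_mx Num.conj_op (M^t* *m M) = M^t* *m M.
  by apply: unitary_coef_real; rewrite -UE.
have [O1 [O2 [o1 [O2R O2O] [d dE]]]] := real_svd GR HR.
have o2 : real_orthogonal O2^T.
  by split; [rewrite -map_trmx O2R|rewrite trmxK; exact: mulmx1C].
pose P m := \sum_i O1 m i *: q i; pose Q m := \sum_i O2^T m i *: q i.
have [uP oP] : (forall m, P m \is unitarymx) /\
    forall m n, \tr ((P m)^t* *m P n) = 2 *+ (m == n) := quaternion_rotation o1.
have [uQ oQ] : (forall m, Q m \is unitarymx) /\
    forall m n, \tr ((Q m)^t* *m Q n) = 2 *+ (m == n) := quaternion_rotation o2.
have ME i j : M i j = \sum_m d 0 m * (O1 m i * O2^T m j).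
  have -> : M = O1^T *m diag_mx d *m O2^T.
    rewrite -dE !mulmxA (mulmx1C o1.2) mul1mx -mulmxA.
    by rewrite O2O mulmx1.
  rewrite mxE; apply: eq_bigr => m _; rewrite mul_mx_diag mxE [O1^T _ _]mxE.
  by rewrite [O1 m i * _]mulrC mulrA.
have Ud : U = \sum_m d 0 m *: (P m *t Q m).
  rewrite UE; under [RHS]eq_bigr => m _.
    rewrite tensmx_suml scaler_sumr; under eq_bigr => i _.
      rewrite tensmx_sumr scaler_sumr; under eq_bigr => j _ do rewrite tensmx_scale scalerA.
      over.
    over.
  rewrite [RHS]exchange_big; apply: eq_bigr => i _ /=.
  rewrite [RHS]exchange_big; apply: eq_bigr => j _ /=.
  by rewrite ME scaler_suml.
(* Polar form of the diagonal. The phase goes into [P], so at a zero entry it is set to 1 to keep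
   [z m *: P m] unitary. *)
pose u m := complex.Re `|d 0 m|; pose z m := if d 0 m == 0 then 1 else d 0 m / `|d 0 m|.
have uE m : (u m)%:C%C = `|d 0 m| :> C by rewrite RRe_real ?normr_real.
have z1 m : `|z m| = 1.
  rewrite /z; case: eqVneq => [_|dm]; first exact: normr1.
  by rewrite normrM normfV normr_id divff // normr_eq0.
have dz m : d 0 m = (u m)%:C%C * z m.
  rewrite uE /z; case: eqVneq => [->|dm]; first by rewrite normr0 mul0r.
  by rewrite mulrC divfK // normr_eq0.
have u0 m : 0 <= u m by rewrite -lecR uE normr_ge0.
have uzP m : z m *: P m \is unitarymx by exact: unitarymxZ.
have ozP m n : \tr ((z m *: P m)^t* *m (z n *: P n)) = 2 *+ (m == n).
  rewrite trmxCZ -scalemxAl -scalemxAr !mxtraceZ oP.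
  case: eqVneq => [->|_]; last by rewrite !mulr0n !mulr0.
  by rewrite mulr1n mulrA [_^* * _]mulrC -normCK z1 expr1n mul1r.
have Uu : U = \sum_m (u m)%:C%C *: ((z m *: P m) *t Q m).
  by rewrite Ud; apply: eq_bigr => m _; rewrite tensmxZl scalerA -dz.
exists u, (fun m => z m *: P m), Q; split=> //; split=> //.
(* The normalization comes from computing [\tr (U^t* *m U) = 4] in two ways. *)
apply: complexI.
have N0 : (2 * 2)%:R != 0 :> C by rewrite pnatr_eq0.
apply: (mulIf N0); rewrite rmorph1 mul1r.
transitivity (\tr (U^t* *m U)); last by rewrite (mulmx1C (unitarymxP uU)) mxtrace1.
rewrite {1}Uu trmxC_sum mulmx_suml linear_sum rmorph_sum mulr_suml; apply: eq_bigr => m _ /=.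
rewrite trmxCZ -scalemxAl mxtraceZ Uu (tr_schmidt u ozP oQ).
have -> : ((u m)%:C%C)^* = (u m)%:C%C :> C by exact: conjc_real.
by rewrite mulrA -rmorphM.
Qed.

End TwoQubitSchmidt.

(** * Tensor powers *)

Section TensorPowers.
Local Open Scope nat_scope.

Lemma eq_binary_digits n s s' : s < 2 ^ n -> s' < 2 ^ n ->
  (forall k, k < n -> s %/ 2 ^ k %% 2 = s' %/ 2 ^ k %% 2) -> s = s'.
Proof.
elim: n s s' => [|n IH] s s'; first by rewrite expn0 !ltnS !leqn0 => /eqP-> /eqP->.
move=> sn sn' ss; rewrite (divn_eq s 2) (divn_eq s' 2).
have := ss 0 isT; rewrite expn0 !divn1 => ->; congr (_ * _ + _).
apply: IH; rewrite ?ltn_divLR -?expnSr // => k kn.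
by rewrite -!divnMA -!expnS; exact: ss.
Qed.

Definition qubits n (s : 'I_(2 ^ n)) : {ffun 'I_n -> 'I_2} := [ffun k => qubit k s].

Lemma qubits_inj n : injective (@qubits n).
Proof.
move=> s s' /ffunP ss; apply: val_inj.
apply: (@eq_binary_digits n); [exact: ltn_ord|exact: ltn_ord|move=> k kn].
have := ss (Ordinal kn); rewrite !ffunE /qubit => /(congr1 val).
by rewrite /= !inordK ?ltn_mod.
Qed.

Lemma qubits_bij n : bijective (@qubits n).
Proof. by apply: inj_card_bij; [exact: qubits_inj|rewrite card_ffun !card_ord]. Qed.

End TensorPowers.

Section TensorPowerMatrices.
Variable C : numClosedFieldType.
Implicit Types n : nat.

(** Distributivity, with basis indices identified with their strings of binary digits. *)
Lemma sum_prod_qubits n (h : 'I_n -> 'I_2 -> C) :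
  \sum_(s < 2 ^ n) \prod_k h k (qubit k s) = \prod_k \sum_b h k b.
Proof.
rewrite bigA_distr_bigA (reindex _ (onW_bij _ (qubits_bij n))).
by apply: eq_bigr => s _; apply: eq_bigr => k _; rewrite ffunE.
Qed.

(** Entries follow the binary digit convention of [bipartite_power], so no iterated tensor product
    has to be regrouped. *)
Definition tensor_prod n (A : 'I_n -> 'M[C]_2) : 'M[C]_(2 ^ n) :=
  \matrix_(r, c) \prod_k A k (qubit k r) (qubit k c).

Lemma tensor_prod_mul n (A B : 'I_n -> 'M[C]_2) :
  tensor_prod A *m tensor_prod B = tensor_prod (fun k => A k *m B k).
Proof.
apply/matrixP => r c; rewrite !mxE.
under [RHS]eq_bigr do rewrite mxE.
rewrite -(sum_prod_qubits (fun k b => A k (qubit k r) b * B k b (qubit k c))).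
by apply: eq_bigr => s _; rewrite !mxE big_split.
Qed.

Lemma tensor_prod1 n : tensor_prod (fun _ : 'I_n => 1%:M) = 1%:M.
Proof.
apply/matrixP => r c; rewrite !mxE; under eq_bigr do rewrite mxE.
case: eqVneq => [->|rc]; first by rewrite big1 // => k _; rewrite eqxx.
have [k kP] : exists k, qubit k r != qubit k c.
  apply/existsP; rewrite -negb_forall; apply: contra rc => /forallP h.
  by apply/eqP/qubits_inj/ffunP => k; rewrite !ffunE; exact/eqP.
by rewrite (bigD1 k) //= (negbTE kP) mul0r.
Qed.

Lemma tensor_prod_trC n (A : 'I_n -> 'M[C]_2) :
  (tensor_prod A)^t* = tensor_prod (fun k => (A k)^t*).
Proof.
apply/matrixP => r c; rewrite !mxE rmorph_prod.
by apply: eq_bigr => k _; rewrite !mxE.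
Qed.

Lemma tensor_prod_trace n (A : 'I_n -> 'M[C]_2) :
  \tr (tensor_prod A) = \prod_k \tr (A k).
Proof.
by rewrite -sum_prod_qubits; apply: eq_bigr => s _; rewrite mxE.
Qed.

Lemma tensor_prod_unitary n (A : 'I_n -> 'M[C]_2) :
  (forall k, A k \is unitarymx) -> tensor_prod A \is unitarymx.
Proof.
move=> uA; apply/unitarymxP; rewrite tensor_prod_trC tensor_prod_mul -tensor_prod1.
apply/matrixP => r c; rewrite !mxE; apply: eq_bigr => k _.
by rewrite (unitarymxP (uA k)).
Qed.

Lemma tensor_prod_orthogonal (I : finType) n (A : I -> 'M[C]_2) :
  (forall i j, \tr ((A i)^t* *m A j) = 2 *+ (i == j)) ->
  forall f g : {ffun 'I_n -> I},
    \tr ((tensor_prod (A \o f))^t* *m tensor_prod (A \o g)) = (2 ^ n)%:R *+ (f == g).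
Proof.
move=> oA f g; rewrite tensor_prod_trC tensor_prod_mul tensor_prod_trace.
rewrite (eq_bigr (fun k => 2 *+ (f k == g k))) => [|k _]; last exact: oA.
case: eqVneq => [->|fg].
  under eq_bigr do rewrite eqxx mulr1n.
  by rewrite prodr_const card_ord natrX mulr1n.
have [k kP] : exists k, f k != g k.
  apply/existsP; rewrite -negb_forall; apply: contra fg => /forallP h.
  by apply/eqP/ffunP => k; exact/eqP.
by rewrite (bigD1 k) //= (negbTE kP) mulr0n mul0r.
Qed.

End TensorPowerMatrices.

Lemma sum_prod_ffun (K : comPzSemiRingType) (I : finType) n (u : I -> K) :
  \sum_(f : {ffun 'I_n -> I}) \prod_k u (f k) = (\sum_i u i) ^+ n.
Proof. by rewrite -(bigA_distr_bigA (fun _ => u)) prodr_const card_ord. Qed.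

Section PowerGamma.
Variable R : realType.
Local Notation C := R[i].

(** Expanding the product over the pairs: [f] selects one Schmidt term for each pair. *)
Lemma bipartite_power_schmidt (I : finType) (u : I -> R) (P Q : I -> 'M[C]_2) n :
  bipartite_power (\sum_i (u i)%:C%C *: (P i *t Q i)) n =
  \sum_(f : {ffun 'I_n -> I}) (\prod_k u (f k))%:C%C *:
    (tensor_prod (P \o f) *t tensor_prod (Q \o f)).
Proof.
apply/matrixP => r c; rewrite mxE summxE.
case: (mxtens_indexP r) => rA rB; case: (mxtens_indexP c) => cA cB.
rewrite !mxtens_indexK.
under eq_bigr => k _ do rewrite summxE.
rewrite bigA_distr_bigA; apply: eq_bigr => f _.
rewrite mxE tensmxE !mxE rmorph_prod -!big_split; apply: eq_bigr => k _ /=.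
by rewrite mxE tensmxE.
Qed.

(** The expanded power is again a Schmidt decomposition into orthogonal unitaries, now indexed by
    functions, and its coefficients sum to the [n]-th power of the original sum. *)
Lemma gamma_power (I : finType) (u : I -> R) (P Q : I -> 'M[C]_2) S n :
  (forall i, P i \is unitarymx) -> (forall i, Q i \is unitarymx) ->
  (forall i j, \tr ((P i)^t* *m P j) = 2 *+ (i == j)) ->
  (forall i j, \tr ((Q i)^t* *m Q j) = 2 *+ (i == j)) ->
  (forall i, 0 <= u i) -> \sum_i u i ^+ 2 = 1 ->
  is_gamma S (unitary_channel (bipartite_power (\sum_i (u i)%:C%C *: (P i *t Q i)) n))
    (2 * ((\sum_i u i) ^+ n) ^+ 2 - 1).
Proof.
move=> uP uQ oP oQ u0 u1; rewrite bipartite_power_schmidt -sum_prod_ffun.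
apply: gamma_schmidt.
- by rewrite expn_gt0.
- by rewrite expn_gt0.
- by move=> f; apply: tensor_prod_unitary => k; exact: uP.
- by move=> f; apply: tensor_prod_unitary => k; exact: uQ.
- exact: tensor_prod_orthogonal.
- exact: tensor_prod_orthogonal.
- by move=> f; apply: prodr_ge0.
under eq_bigr do rewrite -prodrXl.
by rewrite (sum_prod_ffun n (fun i => u i ^+ 2)) u1 expr1n.
Qed.

(** At [n = 2] the gap is [2 * (t - 1) ^+ 2]. In the induction step,
    [(2 * t - 1) * (2 * t ^+ m - 1)] exceeds [2 * t ^+ m.+1 - 1] by [2 * (t - 1) * (t ^+ m - 1)]. *)
Lemma power_gap (t : R) n : 1 < t -> (2 <= n)%N -> 2 * t ^+ n - 1 < (2 * t - 1) ^+ n.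
Proof.
move=> t1; elim: n => // -[|[|n]] // IH _.
  by rewrite -subr_gt0 (_ : _ - _ = 2 * (t - 1) ^+ 2); [nra|ring].
have {}IH := IH isT; set m := n.+2 in IH *.
have tm : 1 <= t ^+ m by rewrite exprn_ege1 // ltW.
have w0 : 0 < 2 * t - 1 by lra.
have step : (2 * t - 1) * (2 * t ^+ m - 1) < (2 * t - 1) ^+ m.+1.
  by rewrite exprS ltr_pM2l.
by apply: le_lt_trans step; rewrite exprS; nra.
Qed.

End PowerGamma.

Theorem corollary4p4 (R : realType) (S : op_class)
    (U : 'M[R[i]]_(2 * 2)) (hU : U \is unitarymx) :
  exists g : R, is_gamma S (unitary_channel U) g /\
    (1 < g -> forall n : nat, (2 <= n)%N ->
      exists gn : R,
        is_gamma S (unitary_channel (bipartite_power U n)) gn /\ gn < g ^+ n).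
Proof.
have [u [P [Q [[uP uQ] oP oQ [u0 u1] ->]]]] := two_qubit_schmidt hU.
exists (2 * (\sum_i u i) ^+ 2 - 1); split; first exact: gamma_schmidt.
move=> g1 n n2; exists (2 * ((\sum_i u i) ^+ n) ^+ 2 - 1); split.
  exact: gamma_power.
(* With [t] the square of the coefficient sum, the hypothesis [1 < g] reads [1 < 2 * t - 1], that is
   [1 < t]. *)
by rewrite exprAC; apply: power_gap => //; lra.
Qed.
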